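(* Let $K$ be a simplicial complex on $[m]$. The algebra isomorphism $\Psi\colon H^*(DJ_K;\mathbb F_2)\xrightarrow{\ \cong\ }\mathbb F_2[K]$ is an isomorphism of $\mathcal A$-algebras.
   Context: $\mathcal A$ is the mod 2 Steenrod algebra. A simplicial complex on $[m]=\{1,\dots,m\}$ is a collection of subsets of $[m]$, closed under taking subsets and containing $\emptyset$. Davis-Januszkiewicz space: $DJ_K=(\mathbb CP^\infty,* )^K=\bigcup_{\sigma\in K}(\mathbb CP^\infty,* )^\sigma\subseteq(\mathbb CP^\infty)^m$, where $(\mathbb CP^\infty,* )^\sigma=\prod_{i=1}^m Y_i$ with $Y_i=\mathbb CP^\infty$ if $i\in\sigma$ and $Y_i=*$ if $i\notin\sigma$. Let $i\colon DJ_K\hookrightarrow(\mathbb CP^\infty)^m$ be the inclusion. Stanley-Reisner algebra: $\mathbb F_2[K]=\mathbb F_2[x_1,\dots,x_m]/I_K$ with $\deg x_i=2$ and $I_K=\langle x_{i_1}\cdots x_{i_k}\mid \{i_1,\dots,i_k\}\notin K\rangle$ (squarefree monomials of non-faces). $\mathcal A$-algebra structure on $\mathbb F_2[K]$: the polynomial algebra $\mathbb F_2[x_1,\dots,x_m]$ has the $\mathcal A$-algebra structure for which the total Steenrod operation $Sq=\sum_{n\ge0}Sq^n$ is the $\mathbb F_2$-algebra map with $Sq(x_i)=x_i+x_i^2$; the ideal $I_K$ is closed under $\mathcal A$, and $\mathbb F_2[K]$ carries the induced structure. The isomorphism $\Psi$ is the known one: let $\Phi\colon H^*((\mathbb CP^\infty)^m;\mathbb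 F_2)\to\mathbb F_2[x_1,\dots,x_m]$ be the algebra isomorphism sending the degree-2 generator of the $i$-th factor to $x_i$. Then $i^*$ is surjective and $\Psi$ is the algebra isomorphism characterized by $\Psi(i^*(a))=[\Phi(a)]$; equivalently, in the cell structure with one cell in each even dimension on $\mathbb CP^\infty$, $\Psi$ sends the cochain dual to a product cell $D_{j_1}^{2k_1}\times\cdots\times D_{j_p}^{2k_p}$ of $DJ_K$ to the class of $x_{j_1}^{k_1}\cdots x_{j_p}^{k_p}$. *)

(* Defs.v *)
From HB Require Import structures.
From mathcomp Require Import all_boot all_order all_algebra.
From mathcomp Require Import generic_quotient ring_quotient complex.
From mathcomp Require Import all_classical all_reals topology normedtype.
From mathcomp Require mpoly.
(* The notations of multinomials clash with those of mathcomp-analysis. *)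
Import -(notations) mpoly.

Set Implicit Arguments.
Unset Strict Implicit.
Unset Printing Implicit Defensive.

Import Order.TTheory GRing.Theory Num.Theory.
Import numFieldTopology.Exports numFieldNormedType.Exports.

Local Open Scope classical_set_scope.
Local Open Scope ring_scope.
Local Open Scope complex_scope.
Local Open Scope quotient_scope.

Section Simplices.
Variable R : realType.

Definition std_simplex (n : nat) : set 'rV[R]_n.+1 :=
  [set t | (forall i, 0 <= t 0 i) /\ \sum_i t 0 i = 1].

Arguments std_simplex : clear implicits.

Definition simplex (n : nat) : topologicalType := set_type (std_simplex n).

Section AffineMap.
Variables (p n : nat) (f : 'I_p.+1 -> 'I_n.+1).

(* The affine map sending the j-th vertex to the (f j)-th one. *)
Definition affine_fun (t : 'rV[R]_p.+1) : 'rV[R]_n.+1 :=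
  \row_k \sum_(j | f j == k) t 0 j.

Lemma affine_fun_subproof (t : simplex p) :
  affine_fun (set_val t) \in std_simplex n.
Proof.
have [t0 t1] : std_simplex p (set_val t) := set_valP t.
apply/mem_set; split; first by move=> k; rewrite mxE; apply: sumr_ge0.
under eq_bigr do rewrite mxE.
by rewrite -t1 [RHS](partition_big f predT).
Qed.

Definition affine (t : simplex p) : simplex n := SigSub (affine_fun_subproof t).

Lemma affine_continuous : continuous affine.
Proof.
apply: continuous_comp_initial => t U /= [P nP PU].
suff H : forall i k, \forall x \near t, P i k (affine_fun (set_val x) i k).
  apply: filterS (filter_forall _ (fun i => filter_forall _ (H i))) => x Px.
  by apply: PU => i j; exact: Px.
move=> i k.
have cts : continuous (fun x : simplex p => affine_fun (set_val x) i k).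
  rewrite (_ : (fun x => _) =
      (fun x : simplex p => \sum_(j | f j == k) set_val x 0 j)); last first.
    by apply/funext => x; rewrite mxE.
  elim: (index_enum _) => [|j r IHr].
    under eq_fun do rewrite big_nil.
    move=> x; rewrite /continuous_at; exact: (@cvg_cst R^o 0 _ (nbhs x) _).
  pose F r' (x : simplex p) := \sum_(l <- r' | f l == k) set_val x 0 l.
  have -> : (fun x : simplex p => \sum_(l <- j :: r | f l == k) set_val x 0 l) =
      (fun x => (if f j == k then set_val x 0 j else 0) + F r x).
    by apply/funext => x; rewrite big_cons /F; case: ifP; rewrite ?add0r.
  move=> x; apply: (@cvgD R R^o _ (nbhs x) _ _ (F r)); last exact: IHr.
  case: ifP => _; last exact: (@cvg_cst R^o 0 _ (nbhs x) _).
  apply: (@continuous_comp _ _ _ set_val (fun M : 'rV[R]_p.+1 => M 0 j)).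
    exact: initial_continuous.
  exact: coord_continuous.
by apply: cts; exact: nP.
Qed.

HB.instance Definition _ :=
  @isContinuous.Build (simplex p) (simplex n) affine affine_continuous.

End AffineMap.
End Simplices.

Section Cochains.
Variables (R : realType) (X : topologicalType).

Record sing := Sing { sdim : nat; smap : continuousType (simplex R sdim) X }.

(* For a nonempty V, the restriction of s to the face spanned by the vertices
   in V, listed in increasing order. *)
Definition vtx n (V : {set 'I_n.+1}) (j : 'I_(#|V|.-1.+1)) : 'I_n.+1 :=
  nth ord0 (enum V) j.

Definition face (s : sing) (V : {set 'I_(sdim s).+1}) : sing :=
  @Sing #|V|.-1 (smap s \o @affine R #|V|.-1 (sdim s) (@vtx (sdim s) V)).

Arguments face : clear implicits.

(* Arbitrary functions on the simplices of all dimensions at once: this is the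
   product of the groups of n-cochains, and the bounded ones form their direct
   sum. *)
Definition cochain := sing -> 'F_2.
HB.instance Definition _ := GRing.Zmodule.on cochain.

Definition bounded_cochain (a : cochain) : Prop :=
  exists N, forall s, (N < sdim s)%N -> a s = 0.

Definition coboundary (a : cochain) : cochain := fun s =>
  if sdim s == 0%N then 0
  else \sum_(i < (sdim s).+1) a (face s (~: [set i])%SET).

Definition is_cocycle (a : cochain) : bool :=
  `[< bounded_cochain a /\ coboundary a = 0 >].

Lemma bounded_cochainB a b :
  bounded_cochain a -> bounded_cochain b -> bounded_cochain (a - b).
Proof.
move=> [M aM] [N bN]; exists (maxn M N) => s.
by rewrite gtn_max => /andP[/aM + /bN]; rewrite !fctE => -> ->; rewrite subr0.
Qed.

Lemma coboundaryB : {morph coboundary : a b / a - b}.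
Proof.
move=> a b; apply/funext => s; rewrite !fctE /coboundary.
by case: ifP => _; rewrite ?subr0 // -sumrB.
Qed.

Lemma coboundary0 : coboundary 0 = 0.
Proof. by rewrite -{1}(subrr 0) coboundaryB subrr. Qed.

Lemma bounded_cochain0 : bounded_cochain 0.
Proof. by exists 0. Qed.

Lemma is_cocycle_zmod : zmod_closed is_cocycle.
Proof.
split=> [|a b /asboolP[ba da] /asboolP[bb db]]; apply/asboolP.
  by split; [exact: bounded_cochain0|exact: coboundary0].
by split; [exact: bounded_cochainB|rewrite coboundaryB da db subrr].
Qed.
HB.instance Definition _ :=
  GRing.isZmodClosed.Build cochain is_cocycle is_cocycle_zmod.

Record cocycle := Cocycle { cval : cochain; _ : cval \in is_cocycle }.
HB.instance Definition _ := [isSub for cval].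
HB.instance Definition _ := [Choice of cocycle by <:].
HB.instance Definition _ := [SubChoice_isSubZmodule of cocycle by <:].

Definition is_exact (z : cocycle) : bool :=
  `[< exists2 b, bounded_cochain b & \val z = coboundary b >].

Lemma is_exact_zmod : zmod_closed is_exact.
Proof.
split=> [|y z /asboolP[a ba ya] /asboolP[b bb zb]]; apply/asboolP.
  by exists 0; [exact: bounded_cochain0|rewrite coboundary0 raddf0].
by exists (a - b); [exact: bounded_cochainB|rewrite coboundaryB -ya -zb raddfB].
Qed.
HB.instance Definition _ :=
  GRing.isZmodClosed.Build cocycle is_exact is_exact_zmod.

Definition exact_cocycles : zmodClosed cocycle :=
  GRing.ZmodClosed.clone cocycle is_exact _.

(* The total cohomology group, the direct sum of the H^n(X; F_2). *)
Definition cohomology := Quotient.quot exact_cocycles.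
HB.instance Definition _ := GRing.Zmodule.on cohomology.

(* The junk value 0 outside the cocycles is never used: each operation on
   cochains to which coh_class is applied below sends cocycles to cocycles. *)
Definition coh_class (a : cochain) : cohomology :=
  \pi_(Quotient.quot exact_cocycles) (insubd (0 : cocycle) a).

Definition coh_rep (x : cohomology) : cochain :=
  \val (repr (x : Quotient.quot exact_cocycles)).

Definition homogeneous_cochain (n : nat) (a : cochain) : Prop :=
  forall s, sdim s <> n -> a s = 0.

Definition coh_degree (n : nat) (x : cohomology) : Prop :=
  exists a, [/\ is_cocycle a, homogeneous_cochain n a & x = coh_class a].

(* Write W = {j_0 < ... < j_i}. Then lblock W consists of the vertices in
   [0, j_0], [j_1, j_2], [j_3, j_4], ..., and rblock W of those in
   [j_0, j_1], [j_2, j_3], ...: these are the faces in Steenrod's formula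
   for the cup-i product. *)
Definition nbelow n (W : {set 'I_n.+1}) (v : 'I_n.+1) : nat :=
  #|[set w in W | (w < v)%N]%SET|.

Definition lblock n (W : {set 'I_n.+1}) : {set 'I_n.+1} :=
  [set v | (v \in W) || ~~ odd (nbelow W v)]%SET.

Definition rblock n (W : {set 'I_n.+1}) : {set 'I_n.+1} :=
  [set v | (v \in W) || odd (nbelow W v)]%SET.

Definition cup_i (i : nat) (a b : cochain) : cochain := fun s =>
  \sum_(W : {set 'I_(sdim s).+1} | #|W| == i.+1)
     a (face s (lblock W)) * b (face s (rblock W)).

(* For i = 0 the formula reads a(s|[0..j]) * b(s|[j..n]), summed over j. *)
Definition cup (a b : cochain) : cochain := cup_i 0 a b.

Definition unit_cochain : cochain := fun s => (sdim s == 0%N)%:R.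

Definition hpart (n : nat) (a : cochain) : cochain := fun s =>
  if sdim s == n then a s else 0.

(* Sq^k a = a cup_(n-k) a if a has degree n >= k, and Sq^k a = 0 if a has degree
   n < k. The components of a of degree n > sdim s do not contribute at s. *)
Definition sq_cochain (k : nat) (a : cochain) : cochain := fun s =>
  \sum_(n < (sdim s).+1 | (k <= n)%N) cup_i (n - k)%N (hpart n a) (hpart n a) s.

Definition coh_mul (x y : cohomology) : cohomology :=
  coh_class (cup (coh_rep x) (coh_rep y)).

Definition coh_one : cohomology := coh_class unit_cochain.

Definition coh_sq (k : nat) (x : cohomology) : cohomology :=
  coh_class (sq_cochain k (coh_rep x)).

End Cochains.

Definition push (R : realType) (X Y : topologicalType) (f : continuousType X Y)
  (s : sing R X) : sing R Y := @Sing R Y (sdim s) (f \o smap s).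

Definition coh_map (R : realType) (X Y : topologicalType)
    (f : continuousType X Y) (y : cohomology R Y) : cohomology R X :=
  coh_class (fun s => coh_rep y (push f s)).

(* An element of the Steenrod algebra is the class, modulo the Adem relations,
   of a sum of monomials Sq^(i_1) ... Sq^(i_r); it acts through the squares. *)
Definition steenrod_elt := seq (seq nat).

Definition steenrod_act (V : zmodType) (sq : nat -> V -> V)
  (theta : steenrod_elt) (v : V) : V := \sum_(w <- theta) foldr sq v w.

(* A_deg n is the degree n part of A. Over F_2, linear means additive. *)
Section AlgebraIso.
Variables (R : realType) (X : topologicalType) (A : comNzRingType).
Variables (A_deg : nat -> A -> Prop) (sqA : nat -> A -> A).

Record algebra_iso (f : cohomology R X -> A) : Prop := AlgebraIso {
  algebra_iso_bij : bijective f;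
  algebra_isoD : {morph f : x y / x + y};
  algebra_iso1 : f (coh_one R X) = 1;
  algebra_isoM : {morph f : x y / coh_mul x y >-> x * y};
  algebra_iso_deg : forall n x, coh_degree n x -> A_deg n (f x) }.

Definition steenrod_linear (f : cohomology R X -> A) : Prop :=
  forall (theta : steenrod_elt) x,
    f (steenrod_act (@coh_sq R X) theta x) = steenrod_act sqA theta (f x).

Definition steenrod_algebra_iso (f : cohomology R X -> A) : Prop :=
  algebra_iso f /\ steenrod_linear f.

End AlgebraIso.

Record simplicial_complex (m : nat) := SimplicialComplex {
  faces : {set {set 'I_m}};
  faces0 : finset.set0 \in faces;
  faces_sub : forall s t : {set 'I_m}, s \subset t -> t \in faces -> s \in faces
}.

Section Polynomials.
Variable m : nat.

Local Notation P := (mpoly m 'F_2).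

Definition x_ (i : 'I_m) : P := mpolyX 'F_2 (mnm1 i).

(* The variables have degree 2. *)
Definition mon_deg (u : multinom m) : nat := (mdeg u).*2.

Lemma mon_deg0 : mon_deg (@mnm0 m) = 0%N.
Proof. by rewrite /mon_deg mdeg0. Qed.

Lemma mon_degD : {morph mon_deg : u v / mnm_add u v >-> (u + v)%N}.
Proof. by move=> u v; rewrite /mon_deg mdegD doubleD. Qed.

HB.instance Definition _ := isMeasure.Build m mon_deg mon_deg0 mon_degD.

Definition poly_deg (n : nat) (p : P) : Prop := p \is ishomog1 n mon_deg.

Definition total_sq (p : P) : P := comp_mpoly [tuple x_ i + x_ i ^+ 2 | i < m] p.

(* Sq^k is the part of the total square raising the degree by k. *)
Definition poly_sq (k : nat) (p : P) : P :=
  \sum_(d < mmeasure mon_deg p)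
     pihomog mon_deg (d + k)%N (total_sq (pihomog mon_deg d p)).

End Polynomials.

Section StanleyReisner.
Variables (m : nat) (K : simplicial_complex m).

Local Notation P := (mpoly m 'F_2).

Definition SR_ideal (p : P) : bool :=
  `[< exists c : {set 'I_m} -> P,
        p = \sum_(s : {set 'I_m} | s \notin faces K) c s * \prod_(i in s) x_ i >].

Lemma SR_ideal_idealr : idealr_closed SR_ideal.
Proof.
split.
- by apply/asboolP; exists (fun=> 0); rewrite big1 // => s _; rewrite mul0r.
- apply/negP => /asboolP[c] /(congr1 (meval (fun=> 0))).
  rewrite rmorph1 raddf_sum big1 => [/eqP|s sK]; first by rewrite oner_eq0.
  have /finset.set0Pn[i si] : s != finset.set0.
    by apply: contraNneq sK => ->; exact: faces0.
  by rewrite /= mevalM (bigD1 i) //= mevalM mevalXU mul0r mulr0.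
- move=> a p q /asboolP[c ->] /asboolP[d ->]; apply/asboolP.
  exists (fun s => a * c s + d s); rewrite mulr_sumr -big_split /=.
  by apply: eq_bigr => s _; rewrite mulrDl mulrA.
Qed.
HB.instance Definition _ := isIdealr.Build P SR_ideal SR_ideal_idealr.

Definition SR_idealr : idealr P := Idealr.clone P SR_ideal _.

Definition SR_algebra := {ideal_quot SR_idealr}.
HB.instance Definition _ := GRing.ComNzRing.on SR_algebra.

Definition SR_class (p : P) : SR_algebra := \pi_({ideal_quot SR_idealr}) p.

Definition SR_deg (n : nat) (x : SR_algebra) : Prop :=
  exists2 p, poly_deg n p & x = SR_class p.

(* The squares induced on the quotient: the ideal is stable under poly_sq. *)
Definition SR_sq (k : nat) (x : SR_algebra) : SR_algebra :=
  SR_class (poly_sq k (repr (x : {ideal_quot SR_idealr}))).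

End StanleyReisner.

Section ProjectiveSpace.
Variable R : realType.

Local Notation C := (R[i]).

(* A polynomial stands for the finitely supported sequence of its coefficients,
   so nzvec is C^oo minus the origin. *)
Definition nzvec := {p : {poly C} | p != 0}.
HB.instance Definition _ := Choice.on nzvec.

(* C^oo minus the origin is the colimit of the spaces C^(n+1) minus the
   origin, which are open in C^(n+1). *)
Definition nzvec_rows (U : set nzvec) (n : nat) : set 'rV[C^o]_n.+1 :=
  [set v | exists2 p : nzvec, \val p = rVpoly (v : 'rV[C]_n.+1) & U p].

Arguments nzvec_rows : clear implicits.

Definition nzvec_open (U : set nzvec) : Prop :=
  forall n, open (nzvec_rows U n).

Lemma open_nz_row n : open [set v : 'rV[C^o]_n.+1 | v != 0].
Proof.
rewrite openE => v /= /eqP v0.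
have [i vi] : exists i, v 0 i != 0.
  apply: contrapT => /forallNP H; apply: v0; apply/rowP => i; rewrite mxE.
  by apply/eqP; have := H i; move/negP; rewrite negbK.
exists (fun k j => [set z : C^o | (k == 0) && (j == i) ==> (z != 0)]).
  move=> k j; have [/andP[/eqP-> /eqP->]|_] := boolP ((k == 0) && (j == i)).
    exists (`|v 0 i|); first by rewrite /= normr_gt0.
    move=> z /= vz; apply/negP => /eqP z0; move: vz.
    by rewrite z0 subr0 ltxx.
  by apply: filterS filterT => z.
move=> w /(_ 0 i) /=; rewrite !eqxx /= => wi.
by apply: contra_neq wi => ->; rewrite mxE.
Qed.

Lemma nzvec_openT : nzvec_open setT.
Proof.
move=> n; rewrite (_ : nzvec_rows _ _ = [set v : 'rV[C^o]_n.+1 | v != 0]).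
  exact: open_nz_row.
apply/seteqP; split=> v /=.
  move=> [p pv _]; apply/eqP => v0; have /eqP := valP p; apply.
  by rewrite [LHS]pv v0 linear0.
move=> v0; have pv0 : rVpoly (v : 'rV[C]_n.+1) != 0.
  by apply: contra_neq v0 => pv0; rewrite -[LHS]rVpolyK pv0 linear0.
by exists (exist (fun p : {poly C} => p != 0) _ pv0).
Qed.

Lemma nzvec_openI : setI_closed nzvec_open.
Proof.
move=> U V oU oV n; rewrite (_ : nzvec_rows _ _ = nzvec_rows U n `&` nzvec_rows V n).
  exact: openI.
apply/seteqP; split=> v /=; first by move=> [p pv [Up Vp]]; split; exists p.
move=> [[p pv Up] [q qv Vq]]; exists p => //; split=> //.
by rewrite (_ : p = q) //; apply: val_inj; rewrite pv qv.
Qed.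

Lemma nzvec_open_bigU (I : Type) (f : I -> set nzvec) :
  (forall i, nzvec_open (f i)) -> nzvec_open (\bigcup_i f i).
Proof.
move=> of_ n; rewrite (_ : nzvec_rows _ _ = \bigcup_i nzvec_rows (f i) n).
  by apply: bigcup_open => i _; exact: of_.
apply/seteqP; split=> v /=; first by move=> [p pv [i _ fp]]; exists i => //; exists p.
by move=> [i _ [p pv fp]]; exists p => //; exists i.
Qed.

HB.instance Definition _ := isOpenTopological.Build nzvec
  nzvec_openT nzvec_openI nzvec_open_bigU.

Definition same_line (p q : nzvec) : bool :=
  `[< exists2 c : C, c != 0 & \val q = c *: \val p >].

Lemma same_line_equiv : equiv_class_of same_line.
Proof.
split=> [p|p q|q p r].
- by apply/asboolP; exists 1; rewrite ?oner_eq0 ?scale1r.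
- apply/asboolP/asboolP => -[c c0 ->]; exists c^-1; rewrite ?invr_eq0 //.
    by rewrite scalerA mulVf // scale1r.
  by rewrite scalerA mulVf // scale1r.
- move=> /asboolP[c c0 qE] /asboolP[d d0 rE]; apply/asboolP.
  by exists (d * c); rewrite ?mulf_neq0 // rE qE scalerA.
Qed.

Canonical same_line_equiv_rel := EquivRelPack same_line_equiv.
Canonical same_line_enc := defaultEncModRel same_line.

Definition CPoo : topologicalType :=
  quotient_topology {eq_quot same_line}.

(* The 0-cell [1 : 0 : 0 : ...], as 1 is the sequence (1, 0, 0, ...). *)
Definition CPoo_base : CPoo :=
  \pi_({eq_quot same_line}) (exist (fun p : {poly C} => p != 0) 1 (oner_neq0 _) : nzvec).

Definition CPoo_power (m : nat) : topologicalType :=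
  prod_topology (fun _ : 'I_m => CPoo).

Lemma cp_coord_cts m (i : 'I_m) :
  continuous ((fun y => y i) : CPoo_power m -> CPoo).
Proof. exact: (@proj_continuous _ (fun _ : 'I_m => CPoo) i). Qed.

Definition cp_coord m (i : 'I_m) : continuousType (CPoo_power m) CPoo :=
  mkcts (@cp_coord_cts m i).

Variables (m : nat) (K : simplicial_complex m).

Definition DJ_set : set (CPoo_power m) :=
  \bigcup_(s in [set s | s \in faces K])
    [set y | forall i, i \notin s -> y i = CPoo_base].

Definition DJ : topologicalType := set_type DJ_set.

Lemma DJ_incl_cts : continuous (set_val : DJ -> CPoo_power m).
Proof. exact: initial_continuous. Qed.

Definition DJ_incl : continuousType DJ (CPoo_power m) := mkcts DJ_incl_cts.

End ProjectiveSpace.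

Definition degree2_generator (R : realType) (g : cohomology R (CPoo R)) : Prop :=
  [/\ coh_degree 2 g, g != 0 & forall x, coh_degree 2 x -> x = 0 \/ x = g].

(* Main.v *)
Require Import Defs.
From HB Require Import structures.
From mathcomp Require Import all_boot all_order all_algebra.
From mathcomp Require Import generic_quotient ring_quotient complex.
From mathcomp Require Import all_classical all_reals topology normedtype.
From mathcomp Require mpoly.
Import -(notations) mpoly.
From mathcomp Require Import ring fintype finset.

Set Implicit Arguments.
Unset Strict Implicit.
Unset Printing Implicit Defensive.

Import Order.TTheory GRing.Theory Num.Theory.
Local Open Scope ring_scope.
Local Open Scope quotient_scope.

(** As Psi (i^* a) = [Phi a] and both Phi and Psi are bijective, every class of DJ_K
    is some i^* a, and by naturality it suffices that Phi carries the squares of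
    (CP^oo)^m to those of the polynomial ring. By additivity this is a statement about
    monomials, and by the Cartan formula for multiplication by x_j it reduces to
    Sq^0 x_j = x_j, Sq^1 x_j = 0 (the polynomial ring has no odd part) and
    Sq^2 x_j = x_j^2. The Cartan formula is proved on cochains: both sides are natural
    Z/2-families of maps from the chains of X to their fourth tensor power, and a
    homotopy between them is built by acyclic models, contracting tensor powers of the
    chains of a simplex by the cone on its first vertex. *)

(** * The boundary of the Steenrod diagonals *)

(** The obstacle is that cup products commute only up to homotopy, so the two sides of the Cartan
    formula are different cochains, and comparing them in one degree [i] drags in all lower ones.
    Let T exchange the two copies of (a, b), and let l_i and r_i be the two sides. Each satisfies d
    l_i + l_i d = l_(i-1) (1 + T), and one looks for h_i with d h_i + h_i d = l_i + r_i + h_(i-1) (1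
    + T). The right-hand side is closed because (1 + T)^2 = 0 mod 2, so h_i exists by acyclicity
    once h_(i-1) does. The last term is the price of equivariance, and it disappears on a, b, a, b,
    which T fixes. Cochains of a simplex are functions on subsets of its vertices, so that boundary
    formulas are identities between finite sums; singular simplices enter only afterwards, through
    naturality. *)

Lemma F2_two : 2%:R = 0 :> 'F_2.
Proof. exact/val_inj. Qed.

Lemma F2_addrr (x : 'F_2) : x + x = 0.
Proof. by ring: F2_two. Qed.

Lemma F2_oppr (x : 'F_2) : - x = x.
Proof. by apply/eqP; rewrite -subr_eq0 -opprD F2_addrr oppr0. Qed.

Section OverlappingPartitions.
Variable n : nat.
Implicit Types (S V W A B : {set 'I_n.+1}) (f : {set 'I_n.+1} -> {set 'I_n.+1} -> 'F_2).

(** Transposed boundary of the augmented simplicial complex: a vertex has the face [set0]. *)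
Definition bd (F : {set 'I_n.+1} -> 'F_2) V : 'F_2 := \sum_(v in V) F (V :\ v).

(* The Steenrod diagonal on the simplex S: for [j = i.+1] it evaluates cup_i, and
   for [j = 0] only W = set0 contributes, with right block set0. *)
Definition diag (j : nat) S f : 'F_2 :=
  \sum_(W : {set 'I_n.+1} | (W \subset S) && (#|W| == j))
     f (S :&: lblock W) (S :&: rblock W).

(* As lblock and rblock, but with the two sides exchanged from [c] on. *)
Definition lcut W (c : nat) : {set 'I_n.+1} :=
  [set u : 'I_n.+1 | (u \in W) || ~~ odd (nbelow W u + (c <= u))]%SET.

Definition rcut W (c : nat) : {set 'I_n.+1} :=
  [set u : 'I_n.+1 | (u \in W) || odd (nbelow W u + (c <= u))]%SET.

Lemma nbelowU1 W v u : v \notin W -> nbelow (v |: W) u = (nbelow W u + (v < u))%N.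
Proof.
move=> vW; rewrite /nbelow; case: ltnP => vu.
  rewrite (_ : finset _ = v |: [set w in W | (w < u)%N]%SET).
    by rewrite cardsU1 !inE (negPf vW) /= addnC.
  apply/setP => w; rewrite !inE.
  by case: eqP => [->|] //=; rewrite vu.
rewrite addn0; congr (#|pred_of_set _|); apply/setP => w; rewrite !inE.
by case: eqP => [->|] //=; rewrite ltnNge vu andbF.
Qed.

Lemma lcut0 W : lcut W 0 = rblock W.
Proof. by apply/setP => u; rewrite !inE leq0n addn1 /= negbK. Qed.

Lemma rcut0 W : rcut W 0 = lblock W.
Proof. by apply/setP => u; rewrite !inE leq0n addn1. Qed.

Lemma lcut_max W : lcut W n.+1 = lblock W.
Proof. by apply/setP => u; rewrite !inE leqNgt ltn_ord addn0. Qed.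

Lemma rcut_max W : rcut W n.+1 = rblock W.
Proof. by apply/setP => u; rewrite !inE leqNgt ltn_ord addn0. Qed.

Lemma cutS W S (v : 'I_n.+1) : (v \in W) || (v \notin S) ->
  (S :&: lcut W v = S :&: lcut W v.+1) * (S :&: rcut W v = S :&: rcut W v.+1).
Proof.
move=> vWS; split; apply/setP => u; rewrite !inE.
  case: (eqVneq u v) vWS => [->|uv _]; first by case: (v \in W) => //= /negPf->.
  by rewrite ltn_neqAle eq_sym (inj_eq val_inj) uv.
case: (eqVneq u v) vWS => [->|uv _]; first by case: (v \in W) => //= /negPf->.
by rewrite ltn_neqAle eq_sym (inj_eq val_inj) uv.
Qed.

(* Cutting at [v] or at [v.+1] only differs in the side on which [v] is put. *)
Lemma cut_block W S (v : 'I_n.+1) f : v \in S -> v \notin W ->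
  f ((S :&: lblock (v |: W)) :\ v) (S :&: rblock (v |: W)) +
  f (S :&: lblock (v |: W)) ((S :&: rblock (v |: W)) :\ v) =
  f (S :&: lcut W v) (S :&: rcut W v) + f (S :&: lcut W v.+1) (S :&: rcut W v.+1).
Proof.
move=> vS vW.
(* Adding [v] to W raises [nbelow] by one strictly above [v], which is the exchange of sides made by
   a cut. The parity of [nbelow W v] decides which of the cuts at [v] and [v.+1] puts [v] on the
   left. *)
have E (b : bool) : (S :&: lblock (v |: W)) :\ v =
    S :&: (if odd (nbelow W v) then lcut W v.+1 else lcut W v) /\
    S :&: rblock (v |: W) =
    S :&: (if odd (nbelow W v) then rcut W v.+1 else rcut W v) /\
    S :&: lblock (v |: W) =
    S :&: (if odd (nbelow W v) then lcut W v else lcut W v.+1) /\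
    (S :&: rblock (v |: W)) :\ v =
    S :&: (if odd (nbelow W v) then rcut W v else rcut W v.+1).
  case: ifP => ov; do !split; apply/setP => u; rewrite !inE nbelowU1 //;
  (case: (eqVneq u v) => [->|uv] /=;
    [by rewrite ?(negPf vW) ?leqnn ?ltnn /= ?addn0 ?addn1 /= ?ov ?andbF ?andbT ?vS
    |by rewrite ?(leq_eqVlt v u) ?(inj_eq val_inj) ?(eq_sym v u) ?(negPf uv)]).
have [-> [-> [-> ->]]] := E true.
by case: ifP => _; rewrite // addrC.
Qed.

(* Removing a vertex outside W gives a term of a face of S. For v in W, put
   W = v |: W': for fixed W' the terms telescope over the cut position. Since set0
   is allowed as a block, the formula holds for all f and j. *)
Lemma bd_diag j S f :
  diag j.+1 S (fun A B => bd (f^~ B) A + bd (f A) B) =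
  \sum_(v in S) diag j.+1 (S :\ v) f + diag j S f + diag j S (fun A B => f B A).
Proof.
pose I (W : {set 'I_n.+1}) := (W \subset S) && (#|W| == j.+1).
have -> : diag j.+1 S (fun A B => bd (f^~ B) A + bd (f A) B) =
  \sum_(W | I W) \sum_(v in S)
    ((if v \in lblock W then f ((S :&: lblock W) :\ v) (S :&: rblock W) else 0) +
    (if v \in rblock W then f (S :&: lblock W) ((S :&: rblock W) :\ v) else 0)).
  apply: eq_bigr => W _; rewrite big_split /=; congr (_ + _).
    by rewrite /bd -big_mkcondr; apply: eq_bigl => v; rewrite inE.
  by rewrite /bd -big_mkcondr; apply: eq_bigl => v; rewrite inE.
under eq_bigr => W _ do rewrite (bigID (fun v => v \notin W)) /=.
rewrite big_split /= -addrA; congr (_ + _).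
  rewrite (exchange_big_dep (mem S)) /=; last by move=> W v _ /andP[].
  apply: eq_bigr => v vS; rewrite /diag; apply: eq_big => W.
    by rewrite /I subsetD1 vS; case: (W \subset S); rewrite //= andbC.
  move=> /andP[_ /andP[_ vW]]; rewrite !inE (negPf vW) /=.
  case: (boolP (odd (nbelow W v))) => ov /=.
    rewrite add0r; congr f; apply/setP => u; rewrite !inE; last by rewrite -andbA.
    by case: (eqVneq u v) => [->|]; rewrite //= (negPf vW) ov andbF.
  rewrite addr0; congr f; apply/setP => u; rewrite !inE; first by rewrite -andbA.
  by case: (eqVneq u v) => [->|]; rewrite //= (negPf vW) (negPf ov) andbF.
transitivity (\sum_(W : {set 'I_n.+1} | (W \subset S) && (#|W| == j))
    \sum_(v | (v \in S) && (v \notin W))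
    (f ((S :&: lblock (v |: W)) :\ v) (S :&: rblock (v |: W)) +
    f (S :&: lblock (v |: W)) ((S :&: rblock (v |: W)) :\ v))).
  under eq_bigr => W IW.
    under eq_bigr => v vW do
      rewrite !inE (negbNE (proj2 (andP vW))) /=.
    over.
  rewrite (exchange_big_dep (mem S)) /=; last by move=> W v _ /andP[].
  rewrite [RHS](exchange_big_dep (mem S)) /=; last by move=> W v _ /andP[].
  apply: eq_bigr => v vS; rewrite (reindex_onto (fun W => v |: W) (fun W => W :\ v)).
    apply: eq_bigl => W; rewrite /I vS subUset sub1set vS /= cardsU1 setU11 !andbT.
    case: (boolP (v \in W)) => vW /=; last by rewrite setU1K // eqxx ?andbT add1n eqSS.
    rewrite andbF; apply/negbTE; rewrite negb_and orbC; apply/orP; left.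
    by apply/negP => /eqP E; move: vW; rewrite -E !inE eqxx.
  by move=> W /andP[_ /andP[_]]; rewrite negbK => vW; rewrite setD1K.
have -> : diag j S f + diag j S (fun A B => f B A) =
  \sum_(W : {set 'I_n.+1} | (W \subset S) && (#|W| == j))
   (f (S :&: lblock W) (S :&: rblock W) + f (S :&: rblock W) (S :&: lblock W)).
  by rewrite big_split.
apply: eq_bigr => W /andP[WS _].
pose q c := f (S :&: lcut W c) (S :&: rcut W c).
have -> : f (S :&: lblock W) (S :&: rblock W) + f (S :&: rblock W) (S :&: lblock W) =
  q n.+1 - q 0%N.
  rewrite /q lcut0 rcut0 lcut_max rcut_max.
  by rewrite F2_oppr.
(* Only a vertex of S outside W changes side when the cut passes it; the other steps are trivial by
   [cutS]. *)
rewrite -(telescope_sumr q) // big_mkord big_mkcond /=; apply: eq_bigr => v _.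
case: ifPn => [/andP[vS vW]|]; last first.
  by rewrite negb_and negbK orbC => /cutS; rewrite /q => E; rewrite !E subrr.
by rewrite cut_block // /q F2_oppr addrC.
Qed.

End OverlappingPartitions.

(** * Acyclic models *)

(* A word of length r stands for a generator of the r-fold tensor power of the
   chains of a simplex, so a function on words is a cochain of that tensor power. *)
Section Words.
Variable n : nat.
Implicit Types (S V A B : {set 'I_n.+1}) (w : seq {set 'I_n.+1}) (x : 'I_n.+1).
Implicit Types (f g : seq {set 'I_n.+1} -> 'F_2).

Fixpoint wbd f w {struct w} : 'F_2 :=
  if w is V :: w' then bd (fun A => f (A :: w')) V + wbd (fun u => f (V :: u)) w'
  else 0.

Definition cone x (F : {set 'I_n.+1} -> 'F_2) V : 'F_2 :=
  if (V != set0) && (x \notin V) then F (x |: V) else 0.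

(* The contraction of a tensor power: cone off the first factor, or project it to
   the cone point and contract the other factors. *)
Fixpoint wcone x f w {struct w} : 'F_2 :=
  if w is V :: w' then
    cone x (fun A => f (A :: w')) V +
    (if #|V| == 1%N then wcone x (fun u => f ([set x] :: u)) w' else 0)
  else 0.

(** The cochains that factor through the augmentation of each tensor power; [c r] is the value on
    words of r vertices. *)
Definition waug (c : nat -> 'F_2) w : 'F_2 :=
  if all (fun V => #|V| == 1%N) w then c (size w) else 0.

(** Words containing [set0] are not generators of the tensor power; admitting them, with value 0,
    spares the boundary formulas a case for vertices. *)
Definition vanishing f := forall w, set0 \in w -> f w = 0.

Lemma bdD (F G : {set 'I_n.+1} -> 'F_2) V :
  bd (fun A => F A + G A) V = bd F V + bd G V.
Proof. exact: big_split. Qed.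

(** Transpose of d(x * V) = V + x * dV. The cone ignores [set0], so for a vertex V the join of [x]
    with the empty face is missing, whence the correction [F [set x]]. If V contains [x] and another
    vertex, only the face opposite [x] contributes. *)
Lemma bd_cone x (F : {set 'I_n.+1} -> 'F_2) V : F set0 = 0 ->
  bd (cone x F) V + cone x (bd F) V = F V + (if #|V| == 1%N then F [set x] else 0).
Proof.
move=> F0; rewrite /bd /cone.
have [->|V0] := eqVneq V set0; first by rewrite big_set0 cards0 F0.
case: (boolP (x \in V)) => xV /=.
  rewrite (bigD1 x) //= setD11 /= setD1K // andbT addr0 [X in _ + X]big1 => [|v /andP[vV vx]].
    rewrite addr0; case: (eqVneq #|V| 1%N) => [/eqP/cards1P[y Vy]|V1].
      by move: xV; rewrite Vy inE => /eqP ->; rewrite setDv eqxx F2_addrr.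
    rewrite addr0 ifT //; apply: contra_neq V1 => V1.
    by rewrite (cardsD1 x) xV V1 cards0.
  by rewrite in_setD1 (eq_sym x) vx xV andbF.
rewrite big_setU1 //= setU1K // addrCA; congr (_ + _).
rewrite -big_split /=.
case: (eqVneq #|V| 1%N) => [/eqP/cards1P[y Vy]|V1].
  have xy : (x == y) = false by move: xV; rewrite Vy inE => /negPf.
  rewrite Vy big_set1 setDv eqxx add0r; congr F.
  apply/setP => u; rewrite !inE; case: (eqVneq u x) => [->|]; rewrite ?orbF ?xy //=.
  by rewrite andNb.
rewrite big1 // => v vV; rewrite ifT.
  rewrite (_ : (x |: V) :\ v = x |: V :\ v) ?F2_addrr //.
  apply/setP => u; rewrite !inE; case: (eqVneq u v) => [->|] //=.
  by case: (eqVneq v x) xV => // <-; rewrite vV.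
rewrite !inE (negPf xV) andbF andbT; apply: contra_neq V1 => V1.
by rewrite (cardsD1 v) vV V1 cards0.
Qed.

Lemma wbd_ext f g w : (forall u, size u = size w -> f u = g u) -> wbd f w = wbd g w.
Proof.
elim: w f g => //= V w IHw f g fg; congr (_ + _).
  by apply: eq_bigr => v _; apply: fg.
by apply: IHw => u uw; apply: fg; rewrite /= uw.
Qed.

Lemma wbd0 w : wbd (fun _ => 0) w = 0.
Proof. by elim: w => //= V w ->; rewrite addr0 /bd big1. Qed.

Lemma wbdD f g w : wbd (fun u => f u + g u) w = wbd f w + wbd g w.
Proof. by elim: w f g => [|V w IHw] f g /=; rewrite ?addr0 // bdD IHw addrACA. Qed.

Lemma wconeD x f g w : wcone x (fun u => f u + g u) w = wcone x f w + wcone x g w.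
Proof.
elim: w f g => [|V w IHw] f g /=; rewrite ?addr0 // IHw /cone.
by case: ifP => _; case: ifP => _; rewrite ?addr0 ?add0r // addrACA.
Qed.

Lemma wcone_ext x f g w : (forall u, f u = g u) -> wcone x f w = wcone x g w.
Proof. by move=> /funext ->. Qed.

Lemma vanishing_cons f V : vanishing f -> vanishing (fun u => f (V :: u)).
Proof. by move=> vf u u0; apply: vf; rewrite inE u0 orbT. Qed.

Lemma vanishing_wcone x f : vanishing f -> vanishing (wcone x f).
Proof.
move=> vf w; elim: w f vf => //= V w IHw f vf; rewrite inE /cone => /orP[/eqP <-|w0].
  by rewrite eqxx cards0 /= addr0.
rewrite vf ?inE ?w0 ?orbT // IHw ?if_same ?addr0 //; exact: vanishing_cons.
Qed.

(** By [bd_cone], coning the first factor deforms it to the point [x]; the induction hypothesis then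
    deforms the remaining factors. The mixed terms occur twice and cancel mod 2. *)
Lemma wbd_wcone x f w : vanishing f ->
  wbd (wcone x f) w + wcone x (wbd f) w =
  f w + waug (fun k => f (nseq k [set x])) w.
Proof.
elim: w f => [|V w IHw] f vf /=; first by rewrite /waug /= addr0 F2_addrr.
have vf0 : f (set0 :: w) = 0 by apply: vf; rewrite inE eqxx.
have vfx : vanishing (fun u => f ([set x] :: u)) by exact: vanishing_cons.
pose c := wcone x (fun u => f ([set x] :: u)) w.
(* The augmentation kills boundaries: an edge has exactly two vertices. *)
have -> : bd (fun A => cone x (fun B => f (B :: w)) A +
      (if #|A| == 1%N then c else 0)) V = bd (cone x (fun A => f (A :: w))) V.
  rewrite bdD [X in _ + X](_ : _ = 0) ?addr0 // /bd.
  case: (eqVneq #|V| 2) => V2; last first.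
    rewrite big1 // => v vV; rewrite ifF //; apply/negbTE.
    by apply: contra_neq V2 => V2; rewrite (cardsD1 v) vV V2.
  rewrite (eq_bigr (fun=> c)) => [|v vV]; last first.
    by rewrite ifT //; move/eqP: V2; rewrite (cardsD1 v) vV add1n eqSS.
  by rewrite sumr_const V2 mulr2n F2_addrr.
have -> : wbd (fun u => cone x (fun A => f (A :: u)) V +
       (if #|V| == 1%N then wcone x (fun u0 => f ([set x] :: u0)) u else 0)) w =
   (if (V != set0) && (x \notin V) then wbd (fun u => f (x |: V :: u)) w else 0) +
   (if #|V| == 1%N then wbd (wcone x (fun u => f ([set x] :: u))) w else 0).
  by rewrite wbdD /cone; congr (_ + _); case: ifP; rewrite ?wbd0.
have -> : cone x (fun A => bd (fun B => f (B :: w)) A + wbd (fun u => f (A :: u)) w) V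
  = cone x (bd (fun A => f (A :: w))) V +
  (if (V != set0) && (x \notin V) then wbd (fun u => f (x |: V :: u)) w else 0).
  by rewrite /cone; case: ifP; rewrite ?addr0.
(* The only face of the point [x] is [set0], where f vanishes. *)
have -> : wcone x (fun u => bd (fun A => f (A :: u)) [set x] +
     wbd (fun u0 => f ([set x] :: u0)) u) w =
     wcone x (wbd (fun u => f ([set x] :: u))) w.
  apply: wcone_ext => u; rewrite /bd big_set1 setDv vf ?add0r //.
  by rewrite inE eqxx.
have := @bd_cone x (fun A => f (A :: w)) V vf0; have := IHw _ vfx.
rewrite /waug /=; set a := bd (cone _ _) _; set b := cone x _ _.
case: (#|V| == 1%N) => /=.
  set p := wbd _ _; set q := wcone _ _ _; set r := if all _ _ then _ else _.
  set s := if _ then _ else _; move=> E1 E2.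
  transitivity (a + b + (p + q) + (s + s)); first by ring.
  rewrite E1 E2 F2_addrr; set y := f _; set z := f _; ring: F2_two.
move=> _ <-; set s := if _ then _ else _.
by rewrite !addr0 addrACA F2_addrr addr0.
Qed.

(** Coning a vertex gives an edge, which has no augmentation, and projecting a vertex to [x] only
    shortens the word. *)
Lemma wcone_waug x c w : wcone x (waug c) w = 0.
Proof.
elim: w c => //= V w IHw c.
rewrite (_ : wcone x _ w = 0) => [|]; last first.
  rewrite -[RHS](IHw (fun k => c k.+1)); apply: wcone_ext => u.
  by rewrite /waug /= cards1.
rewrite if_same addr0 /cone; case: ifP => // /andP[V0 xV].
by rewrite /waug /= cardsU1 xV add1n eqSS cards_eq0 (negPf V0).
Qed.

End Words.

Arguments waug {n} c w.
Arguments vanishing {n} f.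
Arguments wbd {n} f w.

Lemma imset_setD1 (aT rT : finType) (g : aT -> rT) (V : {set aT}) v :
  injective g -> g @: (V :\ v) = (g @: V) :\ g v.
Proof.
move=> gI; apply/setP => y; rewrite !inE; apply/imsetP/andP.
  by move=> [u /setD1P[uv uV] ->]; rewrite (inj_eq gI) mem_imset.
by move=> [+ /imsetP[u uV yE]]; rewrite yE (inj_eq gI) => uv; exists u; rewrite // !inE uv.
Qed.

Lemma wcone_imset k n (g : 'I_k.+1 -> 'I_n.+1) (f : seq {set 'I_n.+1} -> 'F_2) x w :
  injective g ->
  wcone (g x) f (map (fun V : {set _} => g @: V) w) =
  wcone x (fun u => f (map (fun V : {set _} => g @: V) u)) w.
Proof.
move=> gI; elim: w f => //= V w IHw f; rewrite IHw card_imset // /cone.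
by rewrite imset_eq0 mem_imset // imsetU1 imset_set1.
Qed.

(* A chain of a tensor power is encoded by its evaluation on cochains; a family is
   such an element for every simplex S. *)
Definition functional_family : Type :=
  forall n, {set 'I_n.+1} -> (seq {set 'I_n.+1} -> 'F_2) -> 'F_2.

Implicit Types phi : functional_family.

Definition additive_family phi := forall n S (f g : seq {set 'I_n.+1} -> 'F_2),
  phi n S (fun w => f w + g w) = phi n S f + phi n S g.

Definition strictly_mono k n (g : 'I_k.+1 -> 'I_n.+1) :=
  forall i j, (g i < g j)%N = (i < j)%N.

Definition natural_family phi :=
  forall k n (g : 'I_k.+1 -> 'I_n.+1), strictly_mono g ->
  forall (S : {set 'I_k.+1}) f, phi n (g @: S) f =
    phi k S (fun w => f (map (fun V : {set _} => g @: V) w)).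

(** The differential d phi + phi d of the complex of maps from chains to tensor powers, evaluated on
    f. *)
Definition family_bd phi : functional_family := fun n S f =>
  phi n S (wbd f) + \sum_(v in S) phi n (S :\ v) f.
Arguments family_bd : clear implicits.

Definition closed_family phi := forall n S f, @vanishing n f -> family_bd phi n S f = 0.

Lemma strictly_mono_inj k n (g : 'I_k.+1 -> 'I_n.+1) : strictly_mono g -> injective g.
Proof.
move=> gm i j gij; case: (ltngtP i j) => [|| /val_inj //].
  by rewrite -gm gij ltnn.
by rewrite -gm gij ltnn.
Qed.

Lemma strictly_mono_le k n (g : 'I_k.+1 -> 'I_n.+1) i j :
  strictly_mono g -> (g i <= g j)%N = (i <= j)%N.
Proof. by move=> gm; rewrite leqNgt gm -leqNgt. Qed.

Lemma family0 phi n S : additive_family phi -> phi n S (fun _ => 0) = 0.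
Proof.
move=> /(_ n S (fun=> 0) (fun=> 0)); under eq_fun do rewrite addr0.
by move/eqP; rewrite -subr_eq0 opprD addNKr oppr_eq0 => /eqP.
Qed.

(** This is d d = 0: two vertices can be removed in either order. *)
Lemma sum_pairs_F2 n (S : {set 'I_n.+1}) (G : {set 'I_n.+1} -> 'F_2) :
  \sum_(v in S) \sum_(u in S :\ v) G (S :\ v :\ u) = 0.
Proof.
rewrite pair_big_dep /= (bigID (fun p : 'I_n.+1 * 'I_n.+1 => p.1 < p.2)%N) /=.
pose sw (p : 'I_n.+1 * 'I_n.+1) := (p.2, p.1).
rewrite [X in _ + X](reindex_inj (h := sw)) /=; last first.
  by move=> [a b] [c d] /= [-> ->].
rewrite -[RHS](F2_addrr (\sum_(p : 'I_n.+1 * 'I_n.+1 |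
  [&& p.1 \in S, p.2 \in S & (p.1 < p.2)%N]) G (S :\ p.1 :\ p.2))).
congr (_ + _); apply: eq_big => -[u v] //=.
- rewrite !inE; case: (u \in S); case: (v \in S); rewrite ?andbF ?andbT //=.
  case: ltngtP; rewrite ?andbF // => uv; rewrite andbT; apply/eqP => E.
  by move: uv; rewrite E ltnn.
- rewrite !inE -leqNgt; case: (u \in S); case: (v \in S); rewrite ?andbF ?andbT //=.
  by rewrite ltn_neqAle.
by move=> _; congr G; apply/setP => w; rewrite !inE andbCA.
Qed.

(* Acyclic models: an additive closed family without augmentation is a boundary,
   by recursion on the dimension with the cone on the first vertex. *)
Section Contraction.
Variable phi : functional_family.
Arguments phi : clear implicits.

Definition vmin n (S : {set 'I_n.+1}) : 'I_n.+1 :=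
  odflt ord0 [pick x in S | [forall y in S, (x <= y)%N]].

(** On chains, H S = h (phi S + H (dS)), with h the contraction from the first vertex of S;
    transposed, h acts on f. The fuel [k] is the cardinal of S. *)
Fixpoint contract_rec k n (S : {set 'I_n.+1}) f : 'F_2 :=
  if k is k'.+1 then
    phi n S (wcone (vmin S) f) +
    \sum_(v in S) contract_rec k' (S :\ v) (wcone (vmin S) f)
  else 0.

Definition contract : functional_family := fun n S f => contract_rec #|S| S f.
Arguments contract : clear implicits.

Lemma contract_set0 n f : contract _ (set0 : {set 'I_n.+1}) f = 0.
Proof. by rewrite /contract cards0. Qed.

Lemma contractE n (S : {set 'I_n.+1}) f : S != set0 ->
  contract _ S f = phi _ S (wcone (vmin S) f) +
    \sum_(v in S) contract _ (S :\ v) (wcone (vmin S) f).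
Proof.
rewrite -card_gt0 /contract; case ES: #|S| => [//|k] _ /=; congr (_ + _).
apply: eq_bigr => v vS; suff -> : #|S :\ v| = k by [].
by move/eqP: ES; rewrite (cardsD1 v) vS add1n eqSS => /eqP.
Qed.

Lemma set_ind_card n (P : {set 'I_n.+1} -> Prop) :
  P set0 ->
  (forall S, S != set0 -> (forall v, v \in S -> P (S :\ v)) -> P S) ->
  forall S, P S.
Proof.
move=> P0 PS S; elim: {S}#|S| {-2}S (erefl #|S|) => [|k IHk] S ES.
  by rewrite (cards0_eq ES).
apply: PS => [|v vS]; first by rewrite -cards_eq0 ES.
by apply: IHk; move/eqP: ES; rewrite (cardsD1 v) vS add1n eqSS => /eqP.
Qed.

Hypothesis phiD : additive_family phi.

Lemma contractD : additive_family contract.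
Proof.
move=> n S f g; move: S f g; apply: set_ind_card => [|S S0 IHS] f g.
  by rewrite !contract_set0 addr0.
rewrite !contractE // addrACA -big_split /=.
rewrite (_ : wcone _ _ = fun w => wcone (vmin S) f w + wcone (vmin S) g w); last first.
  by apply/funext => w; exact: wconeD.
rewrite phiD; congr (_ + _).
by apply: eq_bigr => v vS; exact: IHS.
Qed.

Lemma contract_waug n S c : contract _ S (@waug n c) = 0.
Proof.
have [->|S0] := eqVneq S set0; first exact: contract_set0.
rewrite contractE // (_ : wcone _ _ = fun=> 0); last first.
  by apply/funext => w; exact: wcone_waug.
rewrite family0 // big1 ?addr0 // => v _; apply: family0; exact: contractD.
Qed.

(** The cone point has to be chosen naturally; this is why naturality is required along
    order-preserving maps and why the first vertex is taken. *)
Lemma vmin_imset k n (g : 'I_k.+1 -> 'I_n.+1) S : strictly_mono g ->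
  S != set0 -> vmin (g @: S) = g (vmin S).
Proof.
move=> gm S0; rewrite /vmin; have gI := strictly_mono_inj gm.
have [x xS xm] : exists2 x, x \in S & forall y, y \in S -> (x <= y)%N.
  have [x0 x0S] := set0Pn _ S0.
  by case: (arg_minnP (fun i : 'I_k.+1 => val i) x0S) => x xS xm; exists x.
case: pickP => [y /andP[/imsetP[y' yS ->] /forall_inP ym]|/(_ (g x))]; last first.
  rewrite mem_imset // xS => /negP[]; apply/forall_inP => _ /imsetP[y yS ->].
  by rewrite strictly_mono_le // xm.
case: pickP => [z /andP[zS /forall_inP zm]|/(_ x)]; last first.
  by rewrite xS => /negP[]; apply/forall_inP.
rewrite /=; congr g; apply/val_inj/eqP; rewrite eqn_leq zm // andbT.
by rewrite -(strictly_mono_le _ _ gm) ym // mem_imset.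
Qed.

Lemma contract_natural : natural_family phi -> natural_family contract.
Proof.
move=> phin k n g gm S f; have gI := strictly_mono_inj gm.
elim/set_ind_card: S f => [|S S0 IHS] f; first by rewrite imset0 !contract_set0.
rewrite !contractE ?imset_eq0 // phin // vmin_imset //.
have E : (fun w => wcone (g (vmin S)) f (map (fun V : {set _} => g @: V) w)) =
  wcone (vmin S) (fun w => f (map (fun V : {set _} => g @: V) w)).
  by apply/funext => w; exact: wcone_imset.
rewrite E big_imset /=; last by move=> i j _ _ /gI.
congr (_ + _); apply: eq_bigr => v vS.
by rewrite -imset_setD1 // IHS // E.
Qed.

Hypothesis phi_set0 : forall n f, phi _ (set0 : {set 'I_n.+1}) f = 0.
Hypothesis phi_waug : forall n S c, phi _ S (@waug n c) = 0.
Hypothesis phi_closed : closed_family phi.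

(** Let z be the chain phi S + H (dS). By induction, d d = 0 and closedness of [phi], z is a cycle;
    it also has no augmentation, so d h z = z, which is the claim. *)
Lemma bd_contract n (S : {set 'I_n.+1}) f :
  vanishing f -> family_bd contract _ S f = phi _ S f.
Proof.
rewrite /family_bd; elim/set_ind_card: S f => [|S S0 IHS] f vf.
  by rewrite contract_set0 big_set0 phi_set0 addr0.
(* [c] is evaluation on the chain z; [c_bd] says that z is a cycle and [c_aug] that its augmentation
   is zero. *)
pose c F := phi _ S F + \sum_(v in S) contract _ (S :\ v) F.
have cD F G : c (fun w => F w + G w) = c F + c G.
  rewrite /c phiD addrACA -big_split; congr (_ + _); apply: eq_bigr => v _.
  exact: contractD.
have c_bd F : vanishing F -> c (wbd F) = 0.
  move=> vF; rewrite /c.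
  rewrite (eq_bigr (fun v => phi n (S :\ v) F +
       \sum_(u in S :\ v) contract n (S :\ v :\ u) F)) => [|v vS]; last first.
    by rewrite -(IHS v vS F vF) -addrA F2_addrr addr0.
  rewrite big_split /= (sum_pairs_F2 S (fun A => contract _ A F)) addr0.
  exact: phi_closed.
have c_aug a : c (waug a) = 0.
  rewrite /c phi_waug add0r big1 // => v _; exact: contract_waug.
rewrite contractE // -/(c _); set x := vmin S.
have -> : wcone x (wbd f) = fun w => f w + (waug (fun k => f (nseq k [set x])) w +
   wbd (wcone x f) w).
  apply/funext => w; rewrite addrA -wbd_wcone // addrC addrA F2_addrr add0r //.
rewrite cD cD c_aug c_bd ?addr0; last exact: vanishing_wcone.
by rewrite /c -addrA F2_addrr addr0.
Qed.

End Contraction.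

(** * The Cartan homotopy *)

Section DiagonalBasics.
Variable n : nat.
Local Notation X := {set 'I_n.+1}.
Implicit Types (S L R A B : X) (F : X -> X -> X -> X -> 'F_2).

Lemma diagD j S (f g : X -> X -> 'F_2) :
  diag j S (fun A B => f A B + g A B) = diag j S f + diag j S g.
Proof. exact: big_split. Qed.

Lemma diag_sum I (r : seq I) (P : pred I) j S (f : I -> X -> X -> 'F_2) :
  \sum_(i <- r | P i) diag j S (f i) =
  diag j S (fun A B => \sum_(i <- r | P i) f i A B).
Proof. exact: exchange_big. Qed.

Lemma eq_diag j S (f g : X -> X -> 'F_2) :
  (forall A B, f A B = g A B) -> diag j S f = diag j S g.
Proof. by move=> fg; apply: eq_bigr => W _. Qed.

Lemma diag_set0 j (f : X -> X -> 'F_2) : diag j.+1 set0 f = 0.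
Proof.
rewrite /diag big_pred0 // => W; apply/andP => -[].
by rewrite subset0 => /eqP ->; rewrite cards0.
Qed.

Lemma diag0 S (f : X -> X -> 'F_2) : (forall A, f A set0 = 0) -> diag 0 S f = 0.
Proof.
move=> f0; rewrite /diag big1 // => W /andP[_]; rewrite cards_eq0 => /eqP ->.
rewrite (_ : S :&: rblock _ = set0) //; apply/setP => u; rewrite !inE /=.
rewrite (_ : nbelow _ _ = 0%N) ?andbF //; apply/eqP; rewrite cards_eq0.
by apply/eqP/setP => w; rewrite !inE.
Qed.

Lemma sum_diag_face j S (f : X -> X -> 'F_2) :
  \sum_(v in S) diag j.+1 (S :\ v) f =
  diag j.+1 S (fun A B => bd (f^~ B) A + bd (f A) B) +
  diag j S (fun A B => f A B + f B A).
Proof. by rewrite bd_diag diagD -[X in X + (_ + _)]addrA -addrA F2_addrr addr0. Qed.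

Lemma diag_const0 j S : diag j S (fun _ _ => 0) = 0.
Proof. by rewrite /diag big1. Qed.

Lemma sum_diag1_face S (f : X -> X -> 'F_2) :
  (forall A, f A set0 = 0) -> (forall A, f set0 A = 0) ->
  \sum_(v in S) diag 1 (S :\ v) f = diag 1 S (fun A B => bd (f^~ B) A + bd (f A) B).
Proof.
move=> f0 f0'; rewrite sum_diag_face diag0 ?addr0 // => A.
by rewrite f0 f0' addr0.
Qed.

Definition diag2 p q L R F : 'F_2 :=
  diag p L (fun A A' => diag q R (F A A')).

Lemma eq_diag2 p q L R F G :
  (forall A A' B B', F A A' B B' = G A A' B B') -> diag2 p q L R F = diag2 p q L R G.
Proof. by move=> FG; apply: eq_diag => A A'; apply: eq_diag. Qed.

Lemma diag2D p q L R F G :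
  diag2 p q L R (fun A A' B B' => F A A' B B' + G A A' B B') =
  diag2 p q L R F + diag2 p q L R G.
Proof. by rewrite -diagD; apply: eq_diag => A A'; rewrite -diagD. Qed.

Lemma bd_diag2 p q L R F :
  bd (fun A => diag2 p.+1 q.+1 A R F) L + bd (fun B => diag2 p.+1 q.+1 L B F) R =
  diag2 p.+1 q.+1 L R (fun A A' B B' =>
    bd (fun A => F A A' B B') A + bd (fun A' => F A A' B B') A' +
    bd (fun B => F A A' B B') B + bd (fun B' => F A A' B B') B') +
  diag2 p q.+1 L R (fun A A' B B' => F A A' B B' + F A' A B B') +
  diag2 p.+1 q L R (fun A A' B B' => F A A' B B' + F A A' B' B).
Proof.
have -> : bd (fun A => diag2 p.+1 q.+1 A R F) L =
    diag2 p.+1 q.+1 L R (fun A A' B B' =>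
      bd (fun A => F A A' B B') A + bd (fun A' => F A A' B B') A') +
    diag2 p q.+1 L R (fun A A' B B' => F A A' B B' + F A' A B B').
  rewrite /diag2 {1}/bd sum_diag_face; congr (_ + _); last first.
    by apply: eq_diag => A A'; rewrite diagD.
  by apply: eq_diag => A A'; rewrite {1 2}/bd !diag_sum -diagD.
have -> : bd (fun B => diag2 p.+1 q.+1 L B F) R =
    diag2 p.+1 q.+1 L R (fun A A' B B' =>
      bd (fun B => F A A' B B') B + bd (fun B' => F A A' B B') B') +
    diag2 p.+1 q L R (fun A A' B B' => F A A' B B' + F A A' B' B).
  rewrite /diag2 {1}/bd diag_sum -diagD; apply: eq_diag => A A'.
  by rewrite sum_diag_face.
rewrite addrACA -diag2D addrA; congr (_ + _ + _).
by apply: eq_diag2 => A A' B B'; rewrite addrA.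
Qed.

Lemma diag2_set0l p q R F : diag2 p.+1 q set0 R F = 0.
Proof. exact: diag_set0. Qed.

Lemma diag2_set0r p q L F : diag2 p q.+1 L set0 F = 0.
Proof.
by rewrite -(diag_const0 p L); apply: eq_diag => A A'; exact: diag_set0.
Qed.

Lemma diag2_0l q L R F : (forall A B B', F A set0 B B' = 0) -> diag2 0 q L R F = 0.
Proof.
move=> F0; apply: diag0 => A; rewrite -(diag_const0 q R); exact: eq_diag.
Qed.

Lemma diag2_0r p L R F : (forall A A' B, F A A' B set0 = 0) -> diag2 p 0 L R F = 0.
Proof.
move=> F0; rewrite -(diag_const0 p L); apply: eq_diag => A A'; exact: diag0.
Qed.

Definition vertex_ind S : 'F_2 := (#|S| == 1%N)%:R.

(** W lies in both blocks, so two one-vertex blocks force [W] to be a vertex equal to both of them;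
    as the blocks cover S, then S = W. Hence the lowest diagonal preserves augmentations and the
    higher ones kill them. *)
Lemma diag_vertex_ind j S :
  diag j.+1 S (fun A B => vertex_ind A * vertex_ind B) = (j == 0%N)%:R * vertex_ind S.
Proof.
have sub (W S' : X) : W \subset S' -> W \subset S' :&: lblock W /\ W \subset S' :&: rblock W.
  by move=> WS; split; rewrite subsetI WS /=; apply/subsetP => u uW; rewrite inE uW.
case: j => [|j]; last first.
  rewrite mul0r /diag big1 // => W /andP[/sub[/subset_leq_card WL _] /eqP W2].
  rewrite /vertex_ind; case: (eqVneq #|_| 1%N) => [L1|_]; last by rewrite mul0r.
  by move: WL; rewrite L1 W2.
rewrite mul1r /diag (eq_bigr (fun W => (S == W)%:R)).
  rewrite -natr_sum /vertex_ind; congr (_%:R).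
  case: (eqVneq #|S| 1%N) => [S1|S1].
    rewrite (bigD1 S) ?subxx ?S1 //= eqxx big1 // => W /andP[_ WS].
    by rewrite eq_sym (negPf WS).
  rewrite big1 // => W /andP[_ /eqP W1]; case: eqP => // SW.
  by rewrite SW W1 in S1.
move=> W /andP[/[dup] WS /sub[WL WR] /eqP W1]; rewrite /vertex_ind -natrM mulnb.
congr (nat_of_bool _)%:R; apply/andP/eqP => [[/eqP L1 /eqP R1]|SW].
  have EL : W = S :&: lblock W by apply/eqP; rewrite eqEcard WL L1 W1.
  have ER : W = S :&: rblock W by apply/eqP; rewrite eqEcard WR R1 W1.
  apply/eqP; rewrite eqEsubset WS andbT; apply/subsetP => u uS.
  case: (boolP (u \in lblock W)) => uL; first by rewrite EL inE uS.
  rewrite ER inE uS inE; move: uL; rewrite inE negb_or negbK.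
  by move=> /andP[_ ->]; rewrite orbT.
rewrite SW; have [WL' WR'] := sub W W (subxx W).
have -> : W :&: lblock W = W by apply/eqP; rewrite eqEsubset subsetIl.
have -> : W :&: rblock W = W by apply/eqP; rewrite eqEsubset subsetIl.
by rewrite W1.
Qed.

End DiagonalBasics.

(** * Symmetries of the fourth tensor power *)

Section Swaps.
Variable n : nat.
Local Notation X := {set 'I_n.+1}.
Implicit Types (f g : seq X -> 'F_2) (w : seq X).

(** The slots of a word are meant for a, b, a, b: [swapL] exchanges the slots of a, [swapR] those of
    b, and their composite [swap] is the action of Z/2 on the square of a two-fold tensor. *)
Definition swapL f w : 'F_2 :=
  if w is [:: A; B; A'; B'] then f [:: A'; B; A; B'] else f w.

Definition swapR f w : 'F_2 :=
  if w is [:: A; B; A'; B'] then f [:: A; B'; A'; B] else f w.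

Lemma wordP (P : seq X -> Prop) :
  (forall w, size w != 4%N -> P w) ->
  (forall A B A' B', P [:: A; B; A'; B']) -> forall w, P w.
Proof.
move=> Pn P4; do 4![case=> [|?]; first exact: Pn].
by case=> [|? ?]; [exact: P4|exact: Pn].
Qed.

Lemma swapL_size f w : size w != 4%N -> swapL f w = f w.
Proof. by case: w => [|? [|? [|? [|? []]]]] // /eqP[]. Qed.

Lemma swapR_size f w : size w != 4%N -> swapR f w = f w.
Proof. by case: w => [|? [|? [|? [|? []]]]] // /eqP[]. Qed.

Lemma wbd_swapL f : wbd (swapL f) = swapL (wbd f).
Proof.
apply/funext; apply: wordP => [w w4|A B A' B'] /=.
  by rewrite swapL_size //; apply: wbd_ext => u uw; rewrite swapL_size // uw.
rewrite !addr0; set a := bd _ _; set b := bd _ _; set c := bd _ _; set d := bd _ _.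
by ring.
Qed.

Lemma wbd_swapR f : wbd (swapR f) = swapR (wbd f).
Proof.
apply/funext; apply: wordP => [w w4|A B A' B'] /=.
  by rewrite swapR_size //; apply: wbd_ext => u uw; rewrite swapR_size // uw.
rewrite !addr0; set a := bd _ _; set b := bd _ _; set c := bd _ _; set d := bd _ _.
by ring.
Qed.

Lemma swapLR f : swapL (swapR f) = swapR (swapL f).
Proof.
apply/funext; apply: wordP => // w w4.
by rewrite swapL_size ?swapR_size ?swapL_size.
Qed.

Definition swap f := swapL (swapR f).

Lemma swapK f : swap (swap f) = f.
Proof.
apply/funext; apply: wordP => // w w4.
by rewrite /swap !(swapL_size, swapR_size).
Qed.

Lemma wbd_swap f : wbd (swap f) = swap (wbd f).
Proof. by rewrite /swap wbd_swapL wbd_swapR. Qed.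

Lemma swapLD f g : swapL (fun w => f w + g w) = fun w => swapL f w + swapL g w.
Proof.
by apply/funext; apply: wordP => // w w4; rewrite !swapL_size.
Qed.

Lemma swapRD f g : swapR (fun w => f w + g w) = fun w => swapR f w + swapR g w.
Proof.
by apply/funext; apply: wordP => // w w4; rewrite !swapR_size.
Qed.

Lemma vanishing_swapL f : vanishing f -> vanishing (swapL f).
Proof.
move=> vf; apply: wordP => [w w4 w0|A B A' B' w0]; first by rewrite swapL_size // vf.
apply: vf; move: w0; rewrite !inE.
by do ![case/orP => [->|]; rewrite ?orbT //] => ->; rewrite ?orbT.
Qed.

Lemma vanishing_swapR f : vanishing f -> vanishing (swapR f).
Proof.
move=> vf; apply: wordP => [w w4 w0|A B A' B' w0]; first by rewrite swapR_size // vf.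
apply: vf; move: w0; rewrite !inE.
by do ![case/orP => [->|]; rewrite ?orbT //] => ->; rewrite ?orbT.
Qed.

Lemma vanishing_add f g : vanishing f -> vanishing g -> vanishing (fun w => f w + g w).
Proof. by move=> vf vg w w0; rewrite vf ?vg ?addr0. Qed.

Lemma swapL_waug c : swapL (@waug n c) = waug c.
Proof.
apply/funext; apply: wordP => [w w4|A B A' B']; first by rewrite swapL_size.
by rewrite /waug /= !andbT; do 4!case: (_ == _).
Qed.

Lemma swapR_waug c : swapR (@waug n c) = waug c.
Proof.
apply/funext; apply: wordP => [w w4|A B A' B']; first by rewrite swapR_size.
by rewrite /waug /= !andbT; do 4!case: (_ == _).
Qed.

End Swaps.

Lemma swapL_imset k n (g : 'I_k.+1 -> 'I_n.+1) (f : seq {set 'I_n.+1} -> 'F_2) :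
  (fun w => swapL f (map (fun V : {set _} => g @: V) w)) =
  swapL (fun w => f (map (fun V : {set _} => g @: V) w)).
Proof.
by apply/funext; apply: wordP => // w w4; rewrite !swapL_size // size_map.
Qed.

Lemma swapR_imset k n (g : 'I_k.+1 -> 'I_n.+1) (f : seq {set 'I_n.+1} -> 'F_2) :
  (fun w => swapR f (map (fun V : {set _} => g @: V) w)) =
  swapR (fun w => f (map (fun V : {set _} => g @: V) w)).
Proof.
by apply/funext; apply: wordP => // w w4; rewrite !swapR_size // size_map.
Qed.

Lemma nbelow_imset k n (g : 'I_k.+1 -> 'I_n.+1) (W : {set 'I_k.+1}) v :
  strictly_mono g -> nbelow (g @: W) (g v) = nbelow W v.
Proof.
move=> gm; have gI := strictly_mono_inj gm.
rewrite /nbelow -(card_imset _ gI); congr (#|pred_of_set _|); apply/setP => u.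
rewrite inE; apply/andP/imsetP => [[/imsetP[w wW ->]]|[w + ->]].
  by rewrite gm => wv; exists w; rewrite // inE wW.
by rewrite inE mem_imset // gm => /andP[].
Qed.

Lemma blocks_imset k n (g : 'I_k.+1 -> 'I_n.+1) (S W : {set 'I_k.+1}) :
  strictly_mono g ->
  (g @: S :&: lblock (g @: W) = g @: (S :&: lblock W)) *
  (g @: S :&: rblock (g @: W) = g @: (S :&: rblock W)).
Proof.
move=> gm; have gI := strictly_mono_inj gm; split; apply/setP => u; rewrite inE.
  apply/andP/imsetP => [[/imsetP[v vS ->]]|[v + ->]].
    by rewrite inE mem_imset // nbelow_imset // => vW; exists v; rewrite // !inE vS.
  by rewrite !inE !mem_imset // nbelow_imset // => /andP[].
apply/andP/imsetP => [[/imsetP[v vS ->]]|[v + ->]].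
  by rewrite inE mem_imset // nbelow_imset // => vW; exists v; rewrite // !inE vS.
by rewrite !inE !mem_imset // nbelow_imset // => /andP[].
Qed.

Lemma diag_imset k n (g : 'I_k.+1 -> 'I_n.+1) j (S : {set 'I_k.+1})
    (f : {set 'I_n.+1} -> {set 'I_n.+1} -> 'F_2) : strictly_mono g ->
  diag j (g @: S) f = diag j S (fun A B => f (g @: A) (g @: B)).
Proof.
move=> gm; have gI := strictly_mono_inj gm.
rewrite /diag (reindex_onto (fun W : {set _} => g @: W) (fun W => g @^-1: W)) /=.
  apply: eq_big => W; last by move=> _; rewrite !blocks_imset.
  rewrite card_imset // (_ : g @^-1: (g @: W) = W) ?eqxx ?andbT.
    congr (_ && _); apply/subsetP/subsetP => WS u.
      by move=> uW; rewrite -(mem_imset _ _ gI) WS // mem_imset.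
    by move=> /imsetP[v /WS vS ->]; rewrite mem_imset.
  by apply/setP => u; rewrite inE mem_imset.
move=> W /andP[/subsetP WS _]; apply/setP => u; apply/imsetP/idP => [[v + ->]|uW].
  by rewrite inE.
by have /imsetP[v vS uE] := WS _ uW; exists v; rewrite // inE -uE.
Qed.

(* The two sides of the Cartan formula, evaluated on (a, b, a, b): cartan_l i is
   (a cup b) cup_i (a cup b), and cartan_r i is the sum of the
   (a cup_p a) cup (b cup_(i-p) b). The swaps, invisible on (a, b, a, b), make
   cartan_r satisfy the same boundary formula as cartan_l. *)
Definition cartan_l (i : nat) : functional_family := fun n S f =>
  diag i.+1 S (fun L R => diag2 1 1 L R (fun A B A' B' => f [:: A; B; A'; B'])).

Definition cartan_block (p q : nat) : functional_family := fun n S f =>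
  diag 1 S (fun L R => diag2 p q L R (fun A A' B B' => f [:: A; B; A'; B'])).

Definition cartan_r (i : nat) : functional_family := fun n S f =>
  \sum_(p < i.+1) cartan_block p.+1 (i - p).+1 S (iter p (@swapR n) f).

Arguments cartan_l : clear implicits.
Arguments cartan_block : clear implicits.
Arguments cartan_r : clear implicits.

Lemma cartan_lD i : additive_family (cartan_l i).
Proof.
move=> n S f g; rewrite /cartan_l -diagD; apply: eq_diag => L R.
by rewrite -diag2D.
Qed.

Lemma cartan_blockD p q : additive_family (cartan_block p q).
Proof.
move=> n S f g; rewrite /cartan_block -diagD; apply: eq_diag => L R.
by rewrite -diag2D.
Qed.

Lemma iter_swapRD n p (f g : seq {set 'I_n.+1} -> 'F_2) :
  iter p (@swapR n) (fun w => f w + g w) =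
  fun w => iter p (@swapR n) f w + iter p (@swapR n) g w.
Proof. by elim: p => //= p ->; rewrite swapRD. Qed.

Lemma cartan_rD i : additive_family (cartan_r i).
Proof.
move=> n S f g; rewrite /cartan_r -big_split; apply: eq_bigr => p _.
by rewrite iter_swapRD cartan_blockD.
Qed.

Lemma cartan_l_set0 i n f : cartan_l i n set0 f = 0.
Proof. exact: diag_set0. Qed.

Lemma cartan_r_set0 i n f : cartan_r i n set0 f = 0.
Proof. by rewrite /cartan_r big1 // => p _; exact: diag_set0. Qed.

Lemma diag2_natural k n (g : 'I_k.+1 -> 'I_n.+1) p q (L R : {set 'I_k.+1}) F :
  strictly_mono g -> diag2 p q (g @: L) (g @: R) F =
  diag2 p q L R (fun A A' B B' => F (g @: A) (g @: A') (g @: B) (g @: B')).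
Proof.
move=> gm; rewrite /diag2 diag_imset //; apply: eq_diag => A A'.
by rewrite diag_imset.
Qed.

Lemma cartan_l_natural i : natural_family (cartan_l i).
Proof.
move=> k n g gm S f; rewrite /cartan_l diag_imset //; apply: eq_diag => L R.
by rewrite diag2_natural.
Qed.

Lemma cartan_block_natural p q : natural_family (cartan_block p q).
Proof.
move=> k n g gm S f; rewrite /cartan_block diag_imset //; apply: eq_diag => L R.
by rewrite diag2_natural.
Qed.

Lemma cartan_r_natural i : natural_family (cartan_r i).
Proof.
move=> k n g gm S f; apply: eq_bigr => p _; rewrite cartan_block_natural //.
by congr cartan_block; elim: (p : nat) => //= j <-; rewrite swapR_imset.
Qed.

Lemma waug4 n c (A B A' B' : {set 'I_n.+1}) : waug c [:: A; B; A'; B'] =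
  c 4%N * (vertex_ind A * vertex_ind B) * (vertex_ind A' * vertex_ind B').
Proof.
rewrite /waug /= /vertex_ind.
by do 4![case: (_ == _) => /=]; rewrite ?(mulr0, mul0r, mulr1, mul1r).
Qed.

Lemma diag_scale n j (S : {set 'I_n.+1}) c f :
  diag j S (fun A B => c * f A B) = c * diag j S f.
Proof. by rewrite /diag mulr_sumr. Qed.

Lemma diag2_vertex_ind n p q (L R : {set 'I_n.+1}) c :
  diag2 p.+1 q.+1 L R (fun A A' B B' =>
    c * (vertex_ind A * vertex_ind A') * (vertex_ind B * vertex_ind B')) =
  c * ((p == 0%N)%:R * (q == 0%N)%:R) * (vertex_ind L * vertex_ind R).
Proof.
rewrite /diag2 (eq_diag _ _ (g := fun A A' => c * (q == 0%N)%:R * vertex_ind R *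
   (vertex_ind A * vertex_ind A'))) => [|A A'].
  by rewrite diag_scale diag_vertex_ind; ring.
by rewrite diag_scale diag_vertex_ind; ring.
Qed.

Lemma cartan_l_waug i n S c : cartan_l i n S (waug c) = c 4%N * (i == 0%N)%:R * vertex_ind S.
Proof.
rewrite /cartan_l (eq_diag _ _ (g := fun L R => c 4%N * (vertex_ind L * vertex_ind R))).
  by rewrite diag_scale diag_vertex_ind mulrA.
move=> L R; have := diag2_vertex_ind 0 0 L R (c 4%N); rewrite /= !mulr1 => <-.
by apply: eq_diag2 => A A' B B'; rewrite waug4.
Qed.

Lemma cartan_block_waug p q n S c : cartan_block p.+1 q.+1 n S (waug c) =
  c 4%N * ((p == 0%N)%:R * (q == 0%N)%:R) * vertex_ind S.
Proof.
rewrite /cartan_block (eq_diag _ _ (g := fun L R =>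
  c 4%N * ((p == 0%N)%:R * (q == 0%N)%:R) * (vertex_ind L * vertex_ind R))).
  by rewrite diag_scale diag_vertex_ind mul1r.
move=> L R; rewrite -diag2_vertex_ind.
by apply: eq_diag2 => A A' B B'; rewrite waug4; ring.
Qed.

Lemma cartan_r_waug i n S c : cartan_r i n S (waug c) = c 4%N * (i == 0%N)%:R * vertex_ind S.
Proof.
rewrite /cartan_r big_ord_recl big1 /= => [|p _].
  by rewrite addr0 cartan_block_waug subn0 /= mul1r.
rewrite (_ : swapR _ = waug c) ?cartan_block_waug /= ?mul0r ?mulr0 ?mul0r //.
elim: {+}(p : nat) => [|j IHj] /=; first exact: swapR_waug.
by rewrite IHj swapR_waug.
Qed.

(** The inner diagonals are those of cup products: their lower terms have a block [set0] and vanish.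
    Only the outer one leaves a term, and exchanging its two blocks is [swap]. *)
Lemma cartan_l_bd i n S (f : seq {set 'I_n.+1} -> 'F_2) : vanishing f ->
  family_bd (cartan_l i) n S f =
  if i is j.+1 then cartan_l j n S (fun w => f w + swap f w) else 0.
Proof.
move=> vf; rewrite /family_bd /cartan_l.
have v4 A B A' B' : (set0 \in [:: A; B; A'; B']) -> f [:: A; B; A'; B'] = 0 by exact: vf.
rewrite sum_diag_face.
rewrite [X in _ + (X + _)](_ : _ = diag i.+1 S (fun L R =>
   diag2 1 1 L R (fun A B A' B' => wbd f [:: A; B; A'; B']))); last first.
  apply: eq_diag => L R; rewrite bd_diag2 diag2_0l ?diag2_0r ?addr0.
  - by apply: eq_diag2 => A B A' B'; rewrite /= addr0 !addrA.
  - by move=> A A' B; rewrite !v4 ?addr0 // !inE eqxx ?orbT.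
  - by move=> A B B'; rewrite !v4 ?addr0 // !inE eqxx ?orbT.
rewrite addrA F2_addrr add0r; case: i => [|i].
  by apply: diag0 => A; rewrite diag2_set0l diag2_set0r addr0.
apply: eq_diag => L R; rewrite diag2D; congr (_ + _).
rewrite /diag2 /diag exchange_big; apply: eq_bigr => W _; apply: eq_bigr => W' _.
by [].
Qed.

Lemma cartan_block_bd p q n S (f : seq {set 'I_n.+1} -> 'F_2) : vanishing f ->
  family_bd (cartan_block p.+1 q.+1) n S f =
  cartan_block p q.+1 n S (fun w => f w + swapL f w) +
  cartan_block p.+1 q n S (fun w => f w + swapR f w).
Proof.
move=> vf; rewrite /family_bd /cartan_block sum_diag1_face; last 2 first.
- by move=> A; exact: diag2_set0r.
- by move=> A; exact: diag2_set0l.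
rewrite -!diagD; apply: eq_diag => L R; rewrite bd_diag2.
rewrite !addrA [X in X + _ + _](_ : _ = 0) ?add0r // -diag2D.
transitivity (diag2 p.+1 q.+1 L R (fun _ _ _ _ => 0)).
  apply: eq_diag2 => A A' B B' /=.
  set a := bd _ _; set b := bd _ _; set c := bd _ _; set d := bd _ _; ring: F2_two.
by rewrite /diag2 -[RHS](diag_const0 p.+1 L); apply: eq_diag => A A'; exact: diag_const0.
Qed.

Lemma cartan_block0l q n S (f : seq {set 'I_n.+1} -> 'F_2) : vanishing f ->
  cartan_block 0 q n S f = 0.
Proof.
move=> vf; rewrite -(diag_const0 1 S); apply: eq_diag => L R.
by apply: diag2_0l => A B B'; apply: vf; rewrite !inE eqxx !orbT.
Qed.

Lemma cartan_block0r p n S (f : seq {set 'I_n.+1} -> 'F_2) : vanishing f ->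
  cartan_block p 0 n S f = 0.
Proof.
move=> vf; rewrite -(diag_const0 1 S); apply: eq_diag => L R.
by apply: diag2_0r => A B B'; apply: vf; rewrite !inE eqxx !orbT.
Qed.

Lemma vanishing_iter_swapR n p (f : seq {set 'I_n.+1} -> 'F_2) :
  vanishing f -> vanishing (iter p (@swapR n) f).
Proof. by move=> vf; elim: p => //= p; exact: vanishing_swapR. Qed.

Lemma wbd_iter_swapR n p (f : seq {set 'I_n.+1} -> 'F_2) :
  iter p (@swapR n) (wbd f) = wbd (iter p (@swapR n) f).
Proof. by elim: p => //= p ->; rewrite wbd_swapR. Qed.

(** The power of [swapR] comes from the diagonal e_i -> sum of e_p (x) T^p e_(i-p) on the standard
    resolution of Z/2. Each lower block receives 1 + [swapL] applied to the p+1-st iterate and 1 +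
    [swapR] applied to the p-th; the p+1-st iterate cancels, and what remains is the p-th iterate of
    f + swap f. *)
Lemma cartan_r_bd i n S (f : seq {set 'I_n.+1} -> 'F_2) : vanishing f ->
  family_bd (cartan_r i) n S f =
  if i is j.+1 then cartan_r j n S (fun w => f w + swap f w) else 0.
Proof.
move=> vf; pose g p := iter p (@swapR n) f.
have vg p : vanishing (g p) by exact: vanishing_iter_swapR.
have vgL p : vanishing (fun w => g p w + swapL (g p) w).
  by apply: vanishing_add => //; exact: vanishing_swapL.
have vgR p : vanishing (fun w => g p w + swapR (g p) w).
  by apply: vanishing_add => //; exact: vanishing_swapR.
have -> : family_bd (cartan_r i) n S f = \sum_(p < i.+1)
   family_bd (cartan_block p.+1 (i - p).+1) n S (g p).
  rewrite /family_bd /cartan_r big_split; congr (_ + _).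
    by apply: eq_bigr => p _; rewrite wbd_iter_swapR.
  by rewrite exchange_big.
under eq_bigr do rewrite cartan_block_bd //.
rewrite big_split /= big_ord_recl cartan_block0l // add0r.
rewrite big_ord_recr /= subnn cartan_block0r // addr0.
case: i => [|i]; first by rewrite !big_ord0 addr0.
rewrite -big_split; apply: eq_bigr => p _ /=.
have pi : (p <= i)%N by rewrite -ltnS.
rewrite /bump leq0n add1n subSS (subSn pi) -cartan_blockD.
congr cartan_block; apply/funext => w.
have E : iter p (@swapR n) (swap f) = swapL (swapR (g p)).
  by rewrite /g; elim: {+}(p : nat) => //= j ->; rewrite [RHS]swapLR.
rewrite iter_swapRD E -/(g p) add0n /=.
set a := swapR (g p) w; set b := swapL _ w; set c := g p w; ring: F2_two.
Qed.

(** What the i-th homotopy has to bound, [psi] being the homotopy of index i-1, or 0 if i = 0. *)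
Definition cartan_source (psi : functional_family) (i : nat) : functional_family :=
  fun n S f => cartan_l i n S f + cartan_r i n S f +
    psi n S (fun w => f w + swap f w).
Arguments cartan_source : clear implicits.

Fixpoint cartan_homotopy (i : nat) : functional_family :=
  contract (cartan_source (if i is j.+1 then cartan_homotopy j else fun _ _ _ => 0) i).
Arguments cartan_homotopy : clear implicits.

Lemma swapD n (f g : seq {set 'I_n.+1} -> 'F_2) :
  swap (fun w => f w + g w) = fun w => swap f w + swap g w.
Proof. by rewrite /swap swapRD swapLD. Qed.

Lemma swap_imset k n (g : 'I_k.+1 -> 'I_n.+1) (f : seq {set 'I_n.+1} -> 'F_2) :
  (fun w => swap f (map (fun V : {set _} => g @: V) w)) =
  swap (fun w => f (map (fun V : {set _} => g @: V) w)).
Proof. by rewrite /swap swapL_imset swapR_imset. Qed.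

Section CartanSource.
Variable psi : functional_family.
Arguments psi : clear implicits.
Variable i : nat.

Hypothesis psiD : additive_family psi.

Lemma cartan_sourceD : additive_family (cartan_source psi i).
Proof.
move=> n S f g; rewrite /cartan_source cartan_lD cartan_rD swapD.
rewrite (_ : (fun w => _) = fun w => (f w + swap f w) + (g w + swap g w)).
  by rewrite psiD [X in X + _ = _]addrACA [LHS]addrACA.
by apply/funext => w; rewrite addrACA.
Qed.

Lemma cartan_source_set0 n f :
  (forall f, psi n set0 f = 0) -> cartan_source psi i n set0 f = 0.
Proof.
by move=> psi0; rewrite /cartan_source cartan_l_set0 cartan_r_set0 psi0 !addr0.
Qed.

Lemma cartan_source_natural : natural_family psi -> natural_family (cartan_source psi i).
Proof.
move=> psin k n g gm S f.
rewrite /cartan_source cartan_l_natural // cartan_r_natural // psin //.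
by rewrite -swap_imset.
Qed.

(** Both sides have the same augmentation, nonzero only for i = 0, and [waug c] is fixed by [swap],
    so that it is doubled under [psi]. *)
Lemma cartan_source_waug n S c :
  cartan_source psi i n S (waug c) = 0.
Proof.
rewrite /cartan_source cartan_l_waug cartan_r_waug F2_addrr add0r.
rewrite /swap swapR_waug swapL_waug (_ : (fun w => _) = fun=> 0) ?family0 //.
by apply/funext => w; rewrite F2_addrr.
Qed.

End CartanSource.

Lemma vanishing_addswap n (f : seq {set 'I_n.+1} -> 'F_2) : vanishing f ->
  vanishing (fun w => f w + swap f w).
Proof.
move=> vf; apply: vanishing_add => //; apply: vanishing_swapL.
exact: vanishing_swapR.
Qed.

(** The first clause, on the preceding homotopy, is carried along because the additivity of [psi] is
    used both for the source in index [i] and for the vanishing of its last term on invariant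
    cochains. *)
Lemma cartan_homotopyP i :
  [/\ additive_family (if i is j.+1 then cartan_homotopy j else fun _ _ _ => 0),
      additive_family (cartan_homotopy i),
      natural_family (cartan_homotopy i),
      forall n f, cartan_homotopy i n set0 f = 0 &
      forall n S f, vanishing f -> family_bd (cartan_homotopy i) n S f =
        cartan_source (if i is j.+1 then cartan_homotopy j else fun _ _ _ => 0) i n S f].
Proof.
elim: i => [|i [IHD' IHD IHn IH0 IHbd]].
  pose src := cartan_source (fun _ _ _ => 0) 0.
  have srcD : additive_family src by apply: cartan_sourceD => n S f g; rewrite addr0.
  split=> [n S f g||||n S f vf]; first by rewrite addr0.
  - exact: contractD.
  - by apply: contract_natural => //; exact: cartan_source_natural.
  - by move=> n f; exact: contract_set0.
  apply: bd_contract => //.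
  - by move=> n' f'; exact: cartan_source_set0.
  - by move=> n' S' c; apply: cartan_source_waug => ? ? ? ?; rewrite addr0.
  move=> n' S' f' vf'.
  have := cartan_l_bd 0 S' vf'; have := cartan_r_bd 0 S' vf'.
  rewrite /family_bd /cartan_source /= => Er El.
  under eq_bigr do rewrite addr0.
  by rewrite addr0 big_split addrACA El Er addr0.
pose src := cartan_source (cartan_homotopy i) i.+1.
have srcD : additive_family src by exact: cartan_sourceD.
split=> [||||n S f vf] //.
- exact: contractD.
- by apply: contract_natural => //; exact: cartan_source_natural.
- by move=> n f; exact: contract_set0.
apply: bd_contract => //.
- by move=> n' f'; exact: cartan_source_set0.
- by move=> n' S' c; exact: cartan_source_waug.
move=> n' S' f' vf'.
have El := cartan_l_bd i.+1 S' vf'; have Er := cartan_r_bd i.+1 S' vf'.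
have Eh := IHbd n' S' _ (vanishing_addswap vf').
have -> : family_bd src n' S' f' = family_bd (cartan_l i.+1) n' S' f' +
  family_bd (cartan_r i.+1) n' S' f' +
  family_bd (cartan_homotopy i) n' S' (fun w => f' w + swap f' w).
  rewrite /family_bd /src /cartan_source !big_split.
  rewrite [in LHS](_ : (fun w => wbd f' w + swap (wbd f') w) =
     wbd (fun w => f' w + swap f' w)).
    set a := cartan_l _ _ _ _; set b := cartan_r _ _ _ _; set c := cartan_homotopy _ _ _ _.
    by rewrite [LHS]addrACA [X in X + _ = _]addrACA.
  by apply/funext => w; rewrite wbdD wbd_swap.
rewrite El Er Eh /cartan_source.
rewrite [X in _ + X = 0](_ : _ = cartan_l i n' S' (fun w => f' w + swap f' w) +
   cartan_r i n' S' (fun w => f' w + swap f' w)) ?F2_addrr //.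
rewrite -[RHS]addr0; congr (_ + _).
(* (1 + T)^2 = 0 mod 2. *)
have -> : (fun w => f' w + swap f' w + swap (fun u => f' u + swap f' u) w) = fun=> 0.
  by apply/funext => w; rewrite swapD swapK (addrC (swap _ _)) F2_addrr.
exact: family0.
Qed.

(** * Faces of singular simplices and cochain operations *)

Arguments face {R X} s V.

Section Faces.
Variables (R : realType) (X : topologicalType).
Implicit Types (s t : sing R X) (a b c : cochain R X).

Lemma affine_comp p q n (f : 'I_q.+1 -> 'I_n.+1) (g : 'I_p.+1 -> 'I_q.+1)
    (t : simplex R p) :
  affine f (@affine R p q g t) = affine (f \o g) t.
Proof.
apply/val_inj/rowP => k; rewrite !mxE.
under eq_bigr do rewrite mxE.
rewrite [RHS](partition_big g (fun j => f j == k)) //=.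
apply: eq_bigr => j /eqP fj; apply: eq_bigl => i.
by case: eqP => [->|]; rewrite ?andbF // fj eqxx.
Qed.

Lemma affine_id p (f : 'I_p.+1 -> 'I_p.+1) (t : simplex R p) :
  f =1 id -> @affine R p p f t = t.
Proof.
move=> fid; apply/val_inj/rowP => k; rewrite !mxE (big_pred1 k) // => j.
by rewrite fid.
Qed.

(** Dimensions of faces, such as [#|U|.-1], agree only propositionally; comparing vertex maps
    through the underlying numbers avoids transports. *)
Lemma eq_sing_affine n (h : continuousType (simplex R n) X) p q
    (f : 'I_p.+1 -> 'I_n.+1) (g : 'I_q.+1 -> 'I_n.+1) :
  p = q -> (forall i j, val i = val j -> f i = g j) ->
  @Sing R X p (h \o affine f) = @Sing R X q (h \o affine g).
Proof.
move=> pq; case: q / pq g => g fg; have -> : f = g by apply/funext => i; exact: fg.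
by [].
Qed.

Lemma eq_sing p (f g : continuousType (simplex R p) X) :
  f =1 g -> Sing f = Sing g.
Proof. by move=> /continuousEP ->. Qed.

Lemma sorted_enum_set m (V : {set 'I_m.+1}) : sorted ltn (map val (enum V)).
Proof.
rewrite (_ : map val (enum V) = [seq i <- iota 0 m.+1 | i \in map val (enum V)]).
  by apply: sorted_filter; [exact: ltn_trans|exact: iota_ltn_sorted].
rewrite -val_enum_ord filter_map enumT /=; congr map.
rewrite {1}/enum_mem; apply: eq_filter => i.
by rewrite /= (mem_map val_inj) mem_enum.
Qed.

Lemma enum_imset_mono k n (g : 'I_k.+1 -> 'I_n.+1) (U : {set 'I_k.+1}) :
  strictly_mono g -> enum (g @: U) = map g (enum U).
Proof.
move=> gm; apply: (inj_map val_inj).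
apply: (@irr_sorted_eq _ ltn); rewrite ?sorted_enum_set //.
- exact: ltn_trans.
- exact: ltnn.
- rewrite -map_comp sorted_map; have := sorted_enum_set U; rewrite sorted_map.
  by apply: sub_sorted => i j /=; rewrite gm.
- move=> x; apply/mapP/mapP => [[y + ->]|[y + ->]].
    rewrite mem_enum => /imsetP[z zU ->]; exists (g z) => //.
    by apply: map_f; rewrite mem_enum.
  move=> /mapP[z]; rewrite mem_enum => zU ->; exists (g z) => //.
  by rewrite mem_enum mem_imset //; exact: strictly_mono_inj.
Qed.

Lemma vtx_imset k n (g : 'I_k.+1 -> 'I_n.+1) (U : {set 'I_k.+1}) i j :
  strictly_mono g -> U != set0 -> val i = val j ->
  vtx (V := g @: U) i = g (vtx (V := U) j).
Proof.
move=> gm U0 ij; rewrite /vtx enum_imset_mono // (nth_map ord0) ?ij //.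
rewrite -cardE; case: j {ij} => j /=; rewrite prednK // card_gt0 //.
Qed.

Lemma vtx_setT n (j : 'I_(#|[set: 'I_n.+1]|.-1.+1)) : val (vtx j) = val j.
Proof.
rewrite /vtx (_ : enum _ = enum 'I_n.+1); last by apply: eq_enum => i; rewrite !inE.
by apply: nth_enum_ord; case: j => j /=; rewrite cardsT card_ord.
Qed.

Lemma vtx_mono n (V : {set 'I_n.+1}) : V != set0 -> strictly_mono (@vtx n V).
Proof.
move=> V0 i j; have sz (k : 'I_(#|V|.-1.+1)) : (k < size (enum V))%N.
  by rewrite -cardE -[X in (_ < X)%N]prednK ?card_gt0.
have H (k l : 'I_(#|V|.-1.+1)) : (k < l)%N -> (vtx k < vtx l)%N.
  move=> kl; rewrite /vtx -!(nth_map ord0 0%N val) //.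
  by apply: (sorted_ltn_nth ltn_trans); rewrite ?sorted_enum_set ?inE ?size_map ?sz.
case: (ltngtP i j) => [/H //|/H|/val_inj ->]; last by rewrite ltnn.
by move=> ji; apply/negbTE; rewrite -leqNgt ltnW.
Qed.

Lemma imset_vtx n (V : {set 'I_n.+1}) : V != set0 -> @vtx n V @: setT = V.
Proof.
move=> V0; apply/setP => i; apply/imsetP/idP => [[j _ ->]|iV].
  rewrite /vtx -mem_enum mem_nth // -cardE; case: j => j /=.
  by rewrite prednK // card_gt0.
have lt : (index i (enum V) < #|V|.-1.+1)%N.
  by rewrite prednK ?card_gt0 // cardE index_mem mem_enum.
by exists (Ordinal lt); rewrite // /vtx /= nth_index ?mem_enum.
Qed.

Lemma face_setT s : face s setT = s.
Proof.
case: s => n h; rewrite /face /=.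
transitivity (@Sing R X n (h \o @affine R n n id)).
  apply: eq_sing_affine => [|i j ij]; first by rewrite cardsT card_ord.
  by apply/val_inj; rewrite vtx_setT ij.
by apply: eq_sing => t /=; rewrite affine_id.
Qed.

Lemma face_face s (V : {set 'I_(sdim s).+1}) (U : {set 'I_(sdim (face s V)).+1}) :
  V != set0 -> U != set0 -> face (face s V) U = face s (vtx (V := V) @: U).
Proof.
case: s V U => n h V U V0 U0; rewrite /face /=.
have vm := vtx_mono V0.
transitivity (@Sing R X #|U|.-1 (h \o @affine R #|U|.-1 n (@vtx n V \o @vtx _ U))).
  by apply: eq_sing => t /=; rewrite affine_comp.
apply: eq_sing_affine => [|i j ij].
  by rewrite card_imset //; exact: strictly_mono_inj.
by rewrite /= (@vtx_imset _ _ (@vtx n V) U j i).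
Qed.

(** [face s set0] is a junk vertex. Replacing its value by 0 makes [coboundary] correspond to [bd]
    and [cup_i] to [diag] on every subset. *)
Definition on_face s a (V : {set 'I_(sdim s).+1}) : 'F_2 :=
  if V == set0 then 0 else a (face s V).
Arguments on_face : clear implicits.

End Faces.

Arguments on_face {R X} s a V.

(** * Coboundary and Cartan formulas for cochains *)

Section CochainOperations.
Variables (R : realType) (X : topologicalType).
Implicit Types (s t : sing R X) (a b c : cochain R X).

Lemma on_face_setT s a : on_face s a setT = a s.
Proof.
rewrite /on_face face_setT ifN //; apply/set0Pn; exists ord0; exact: in_setT.
Qed.

Lemma on_face0 s a : on_face s a set0 = 0.
Proof. by rewrite /on_face eqxx. Qed.

Lemma on_face_face s a (V : {set 'I_(sdim s).+1}) (U : {set 'I_(sdim (face s V)).+1}) :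
  V != set0 -> on_face (face s V) a U = on_face s a (vtx (V := V) @: U).
Proof.
move=> V0; rewrite /on_face imset_eq0; case: eqP => // /eqP U0.
by rewrite face_face.
Qed.

Lemma on_face_coboundary s a V : on_face s (coboundary a) V = bd (on_face s a) V.
Proof.
have [->|V0] := eqVneq V set0; first by rewrite on_face0 /bd big_set0.
rewrite {1}/on_face (negPf V0) /coboundary /=.
case: eqP => [V1|/eqP V1].
  have /cards1P[v ->] : #|V| == 1%N by rewrite -[#|V|]prednK ?card_gt0 // V1.
  by rewrite /bd big_set1 setDv on_face0.
have vm := vtx_mono V0; have vI := strictly_mono_inj vm.
rewrite /bd -[in RHS](imset_vtx V0) big_imset /=; last by move=> i j _ _ /vI.
apply: eq_big => [i|i _]; first by rewrite in_setT.
rewrite -imset_setD1 // setTD.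
have C0 : ~: [set i] != set0.
  rewrite -card_gt0 cardsC1 card_ord /=.
  by case: (#|V|.-1) V1.
by rewrite /on_face imset_eq0 (negPf C0) face_face.
Qed.

Lemma on_face_cup_i i s a b V : on_face s (cup_i i a b) V =
  diag i.+1 V (fun A B => on_face s a A * on_face s b B).
Proof.
have [->|V0] := eqVneq V set0; first by rewrite on_face0 diag_set0.
rewrite {1}/on_face (negPf V0) /cup_i.
rewrite -[in RHS](imset_vtx V0) diag_imset; last exact: vtx_mono.
apply: eq_big => [W|W /eqP W1]; first by rewrite subsetT.
have [w wW] : exists w, w \in W by apply/set0Pn; rewrite -card_gt0 W1.
rewrite !setTI -!on_face_face //; congr (_ * _); rewrite /on_face ifN //.
  by apply/set0Pn; exists w; rewrite inE wW.
by apply/set0Pn; exists w; rewrite inE wW.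
Qed.

(** A natural family defines a cochain through its value on the full simplex; the condition on F is
    that relabelling vertices commutes with it. *)
Lemma on_face_natural (phi : functional_family)
    (F : forall n, ({set 'I_n.+1} -> 'F_2) -> ({set 'I_n.+1} -> 'F_2) ->
       seq {set 'I_n.+1} -> 'F_2) a b s V :
  natural_family phi -> (forall n f, phi n set0 f = 0) ->
  (forall k n (g : 'I_k.+1 -> 'I_n.+1) f h w,
     F k (fun U => f (g @: U)) (fun U => h (g @: U)) w =
     F n f h (map (fun U : {set _} => g @: U) w)) ->
  on_face s (fun t => phi _ setT (F _ (on_face t a) (on_face t b))) V =
  phi _ V (F _ (on_face s a) (on_face s b)).
Proof.
move=> phin phi0 FE.
have [->|V0] := eqVneq V set0; first by rewrite on_face0 phi0.
rewrite {1}/on_face (negPf V0) -[in RHS](imset_vtx V0) phin; last exact: vtx_mono.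
congr phi; apply/funext => w; rewrite -FE; congr F; apply/funext => U.
  by rewrite on_face_face.
by rewrite on_face_face.
Qed.

Lemma coboundary_cup_iS i a b : coboundary (cup_i i.+1 a b) =
  cup_i i.+1 (coboundary a) b + cup_i i.+1 a (coboundary b) +
  (cup_i i a b + cup_i i b a).
Proof.
apply/funext => s; rewrite -on_face_setT on_face_coboundary.
rewrite (_ : on_face _ _ =
  diag i.+2 ^~ (fun A B => on_face s a A * on_face s b B)); last first.
  by apply/funext => V; rewrite on_face_cup_i.
rewrite {1}/bd sum_diag_face !fctE -!(on_face_setT s) !on_face_cup_i -!diagD.
congr (_ + _); apply: eq_diag => A B; rewrite ?on_face_coboundary.
  by rewrite /bd mulr_suml mulr_sumr.
by rewrite [X in _ + X]mulrC.
Qed.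

Lemma coboundary_cup a b : coboundary (cup a b) =
  cup (coboundary a) b + cup a (coboundary b).
Proof.
apply/funext => s; rewrite -on_face_setT on_face_coboundary /cup.
rewrite (_ : on_face _ _ =
  diag 1 ^~ (fun A B => on_face s a A * on_face s b B)); last first.
  by apply/funext => V; rewrite on_face_cup_i.
rewrite {1}/bd sum_diag1_face; last 2 first.
- by move=> A; rewrite on_face0 mulr0.
- by move=> A; rewrite on_face0 mul0r.
rewrite !fctE -!(on_face_setT s) !on_face_cup_i -!diagD.
apply: eq_diag => A B; rewrite ?on_face_coboundary.
by rewrite /bd mulr_suml mulr_sumr.
Qed.

Definition eval4 n (f g : {set 'I_n.+1} -> 'F_2) w : 'F_2 :=
  if w is [:: A; B; A'; B'] then f A * g B * (f A' * g B') else 0.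

Lemma eval4_imset k n (h : 'I_k.+1 -> 'I_n.+1) (f g : {set 'I_n.+1} -> 'F_2) w :
  eval4 (fun U => f (h @: U)) (fun U => g (h @: U)) w =
  eval4 f g (map (fun U : {set _} => h @: U) w).
Proof. by case: w => [|? [|? [|? [|? []]]]]. Qed.

Lemma swapL_eval4 n (f g : {set 'I_n.+1} -> 'F_2) : swapL (eval4 f g) = eval4 f g.
Proof.
apply/funext; apply: wordP => [w w4|A B A' B'] /=; first by rewrite swapL_size.
by ring.
Qed.

Lemma swapR_eval4 n (f g : {set 'I_n.+1} -> 'F_2) : swapR (eval4 f g) = eval4 f g.
Proof.
apply/funext; apply: wordP => [w w4|A B A' B'] /=; first by rewrite swapR_size.
by ring.
Qed.

Lemma vanishing_eval4 n (f g : {set 'I_n.+1} -> 'F_2) : f set0 = 0 -> g set0 = 0 ->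
  vanishing (eval4 f g).
Proof.
move=> f0 g0; case=> [|A [|B [|A' [|B' []]]]] //=; rewrite !inE.
by do ![case/orP]=> /eqP <-; rewrite ?f0 ?g0 ?mulr0 ?mul0r ?mulr0.
Qed.

Lemma wbd_eval4 n (f g : {set 'I_n.+1} -> 'F_2) : bd f = (fun=> 0) -> bd g = (fun=> 0) ->
  wbd (eval4 f g) = fun=> 0.
Proof.
move=> f0 g0; apply/funext; apply: wordP => [w w4|A B A' B'] /=.
  rewrite -(wbd0 w); apply: wbd_ext => u uw.
  by case: u w4 uw => [|? [|? [|? [|? []]]]] //= /[swap] <- /eqP.
have fE (V : {set 'I_n.+1}) : \sum_(v in V) f (V :\ v) = 0 by rewrite -[LHS]/(bd _ V) f0.
have gE (V : {set 'I_n.+1}) : \sum_(v in V) g (V :\ v) = 0 by rewrite -[LHS]/(bd _ V) g0.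
by rewrite /bd -!(mulr_suml, mulr_sumr) !fE !gE !(mulr0, mul0r, addr0).
Qed.

Lemma diag_mul n p q (L R' : {set 'I_n.+1}) f g :
  diag p L f * diag q R' g = diag2 p q L R' (fun A A' B B' => f A A' * g B B').
Proof.
rewrite /diag2 /diag mulr_suml; apply: eq_bigr => W _.
by rewrite mulr_sumr.
Qed.

(** The homotopy formula evaluated on a, b, a, b: [wbd] of this tensor is zero as a and b are
    cocycles, and the faces of the homotopy make up the coboundary of [c]. *)
Lemma cartan_cochain i a b : coboundary a = 0 -> coboundary b = 0 ->
  exists c, cup_i i (cup a b) (cup a b) +
    \sum_(p < i.+1) cup (cup_i p a a) (cup_i (i - p) b b) = coboundary c.
Proof.
move=> a0 b0; have [psiD _ phin phi0 phibd] := cartan_homotopyP i.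
exists (fun s => cartan_homotopy i _ setT (eval4 (on_face s a) (on_face s b))).
apply/funext => s; rewrite -[RHS]on_face_setT on_face_coboundary.
rewrite (_ : on_face _ _ =
  cartan_homotopy i _ ^~ (eval4 (on_face s a) (on_face s b))); last first.
  apply/funext => V.
  by apply: (on_face_natural (F := eval4)) => // *; rewrite eval4_imset.
have bd0 d : coboundary d = 0 -> bd (on_face s d) = fun=> 0.
  move=> d0; apply/funext => V; rewrite -on_face_coboundary d0 /on_face.
  by rewrite if_same.
have := phibd _ setT _ (vanishing_eval4 (on_face0 s a) (on_face0 s b)).
rewrite /family_bd wbd_eval4 ?bd0 // family0; last by case: (cartan_homotopyP i).
rewrite add0r /bd => ->; rewrite /cartan_source /swap swapR_eval4 swapL_eval4.
(* The preceding homotopy is applied to e + swap e, which is 2e = 0. *)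
set e := eval4 _ _; have -> : (fun w => e w + e w) = fun=> 0.
  by apply/funext => w; rewrite F2_addrr.
rewrite family0 // addr0 fctE; congr (_ + _).
  rewrite -on_face_setT on_face_cup_i; apply: eq_diag => A B.
  by rewrite !on_face_cup_i diag_mul.
rewrite fct_sumE; apply: eq_bigr => p _.
have -> : iter p (@swapR _) e = e.
  by elim: {+}(p : nat) => //= j ->; rewrite swapR_eval4.
rewrite -on_face_setT on_face_cup_i; apply: eq_diag => A B.
rewrite !on_face_cup_i diag_mul; apply: eq_diag2 => A1 A2 B1 B2 /=.
by ring.
Qed.

End CochainOperations.

(** * Steenrod squares in cohomology *)

Section Cohomology.
Variables (R : realType) (X : topologicalType).
Implicit Types (s t : sing R X) (a b c : cochain R X).
Implicit Types (x y : cohomology R X).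

Lemma cochain_addrr a : a + a = 0.
Proof. by apply/funext => s; exact: F2_addrr. Qed.

Lemma cochain_oppr a : - a = a.
Proof. by apply/funext => s; exact: F2_oppr. Qed.

Lemma coboundaryD a b : coboundary (a + b) = coboundary a + coboundary b.
Proof. by rewrite -[b in LHS]cochain_oppr coboundaryB cochain_oppr. Qed.

Lemma coboundary_ext s a b : (forall t, (sdim t).+1 = sdim s -> a t = b t) ->
  coboundary a s = coboundary b s.
Proof.
move=> ab; rewrite /coboundary; case: eqP => // /eqP s0.
apply: eq_bigr => i _; apply: ab => /=.
by rewrite cardsC1 card_ord; case: (sdim s) s0.
Qed.

Definition vanishes_above (N : nat) a := forall s, (N < sdim s)%N -> a s = 0.

Lemma is_cocycleP a : reflect (bounded_cochain a /\ coboundary a = 0) (is_cocycle a).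
Proof. exact: asboolP. Qed.

Lemma coboundary_cocycle a : is_cocycle a -> coboundary a = 0.
Proof. by case/is_cocycleP. Qed.

Lemma bounded_cocycle a : is_cocycle a -> bounded_cochain a.
Proof. by case/is_cocycleP. Qed.

Lemma cocycle0 : is_cocycle (0 : cochain R X).
Proof.
by apply/is_cocycleP; split; [exact: bounded_cochain0|exact: coboundary0].
Qed.

Lemma cocycleD a b : is_cocycle a -> is_cocycle b -> is_cocycle (a + b).
Proof.
move=> /is_cocycleP[ba ca] /is_cocycleP[bb cb]; apply/is_cocycleP.
split; last by rewrite coboundaryD ca cb addr0.
by rewrite -[b]cochain_oppr; exact: bounded_cochainB.
Qed.

Lemma cocycle_sum I (r : seq I) (P : pred I) (F : I -> cochain R X) :
  (forall i, P i -> is_cocycle (F i)) -> is_cocycle (\sum_(i <- r | P i) F i).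
Proof.
by move=> cF; apply: (big_ind (@is_cocycle R X)) => //; [exact: cocycle0|exact: cocycleD].
Qed.

Lemma coh_class_val a (ca : is_cocycle a) :
  coh_class a = \pi_(Quotient.quot (exact_cocycles R X)) (Cocycle ca).
Proof.
by rewrite /coh_class /insubd insubT.
Qed.

Lemma coh_class_eqP a b : is_cocycle a -> is_cocycle b ->
  coh_class a = coh_class b <-> exists2 c, bounded_cochain c & a + b = coboundary c.
Proof.
move=> ca cb; rewrite (coh_class_val ca) (coh_class_val cb); split.
  move=> /eqP; rewrite -Quotient.idealrBE => /asboolP[c bc /= E].
  by exists c => //; rewrite -E cochain_oppr.
move=> [c bc E]; apply/eqP; rewrite -Quotient.idealrBE; apply/asboolP.
by exists c => //=; rewrite cochain_oppr.
Qed.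

(* If the coboundary of c is bounded, then c may be truncated, so that c itself
   need not be bounded. *)
Lemma coh_class_eq a b c : is_cocycle a -> is_cocycle b -> a + b = coboundary c ->
  coh_class a = coh_class b.
Proof.
move=> ca cb E; apply/coh_class_eqP => //.
have [N vN] : bounded_cochain (a + b) by case/is_cocycleP: (cocycleD ca cb).
exists (fun s => if (sdim s <= N)%N then c s else 0).
  by exists N => s; rewrite ltnNge => /negPf ->.
apply/funext => s; case: (leqP (sdim s) N.+1) => sN.
  by rewrite E; apply: coboundary_ext => t ts; rewrite -ltnS ts sN.
rewrite vN; last exact: ltnW.
rewrite (@coboundary_ext s _ 0) ?coboundary0 // => t ts.
by rewrite leqNgt; move: sN; rewrite -ts ltnS => ->.
Qed.

Lemma coh_rep_cocycle x : is_cocycle (coh_rep x).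
Proof. by rewrite /coh_rep; case: (repr _). Qed.

Lemma coh_repK x : coh_class (coh_rep x) = x.
Proof.
rewrite (coh_class_val (coh_rep_cocycle x)) -[RHS]reprK; congr (\pi _).
exact: val_inj.
Qed.

Lemma coh_rep_class a : is_cocycle a ->
  exists c, coh_rep (coh_class a) = a + coboundary c.
Proof.
move=> ca; have := coh_repK (coh_class a).
move=> /(coh_class_eqP (coh_rep_cocycle _) ca)[c _ E].
by exists c; rewrite -E addrCA cochain_addrr addr0.
Qed.

Lemma coh_classD a b : is_cocycle a -> is_cocycle b ->
  coh_class (a + b) = coh_class a + coh_class b.
Proof.
move=> ca cb; rewrite (coh_class_val (cocycleD ca cb)) (coh_class_val ca) (coh_class_val cb).
rewrite -raddfD; congr (\pi _); exact: val_inj.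
Qed.

Lemma coh_class0 : coh_class (0 : cochain R X) = 0.
Proof.
rewrite (coh_class_val cocycle0) -[RHS](raddf0 (\pi_(Quotient.quot (exact_cocycles R X)))).
congr (\pi _); exact: val_inj.
Qed.

Lemma coh_class_sum I (r : seq I) (P : pred I) (F : I -> cochain R X) :
  (forall i, P i -> is_cocycle (F i)) ->
  coh_class (\sum_(i <- r | P i) F i) = \sum_(i <- r | P i) coh_class (F i).
Proof.
move=> cF; elim: r => [|i r IHr]; first by rewrite !big_nil coh_class0.
rewrite !big_cons; case: ifP => // Pi.
by rewrite coh_classD ?IHr //; [exact: cF|exact: cocycle_sum].
Qed.

Lemma coh_class_coboundary a c : is_cocycle a -> a = coboundary c -> coh_class a = 0.
Proof.
move=> ca E; rewrite -coh_class0; apply: (coh_class_eq (c := c)) => //.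
  exact: cocycle0.
by rewrite addr0.
Qed.

(** The blocks cover the simplex and meet exactly in W. With [#|W|] equal to i+1, their dimensions
    add up to [sdim s + i], so cup_i lowers the total degree by i. *)
Lemma card_blocks s (W : {set 'I_(sdim s).+1}) :
  (#|lblock W| + #|rblock W| = (sdim s).+1 + #|W|)%N.
Proof.
rewrite -cardsUI; congr (_ + _)%N.
  rewrite (_ : _ :|: _ = setT) ?cardsT ?card_ord //; apply/setP => u; rewrite !inE.
  by case: (u \in W); case: (odd _).
congr (#|pred_of_set _|); apply/setP => u; rewrite !inE.
by case: (u \in W); case: (odd _).
Qed.

Lemma vanishes_above_cup_i i M N a b :
  vanishes_above M a -> vanishes_above N b -> vanishes_above (M + N) (cup_i i a b).
Proof.
move=> va vb s sMN; rewrite /cup_i big1 // => W /eqP W1.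
have := card_blocks W; rewrite W1 => E.
have [La|La] := ltnP M #|lblock W|.-1; first by rewrite va ?mul0r.
rewrite [X in _ * X]vb ?mulr0 //= ltnNge; apply/negP => Ra.
have: ((sdim s).+1 + i.+1 <= M.+1 + N.+1)%N.
  rewrite -E; apply: leq_add; [move: La|move: Ra].
    by case: #|lblock W|.
  by case: #|rblock W|.
rewrite addSn !addnS !ltnS => H.
by have := leq_trans (leq_addr i _) H; rewrite leqNgt sMN.
Qed.

Lemma bounded_cup_i i a b :
  bounded_cochain a -> bounded_cochain b -> bounded_cochain (cup_i i a b).
Proof. by move=> [M va] [N vb]; exists (M + N)%N; exact: vanishes_above_cup_i. Qed.

Lemma homogeneous_cup_i i p q n a b : homogeneous_cochain p a ->
  homogeneous_cochain q b -> (n + i = p + q)%N -> homogeneous_cochain n (cup_i i a b).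
Proof.
move=> ha hb pqn s sn; rewrite /cup_i big1 // => W /eqP W1.
have := card_blocks W; rewrite W1 => E.
have [La|La] := eqVneq #|lblock W|.-1 p; last by rewrite ha ?mul0r //; exact/eqP.
rewrite [X in _ * X]hb ?mulr0 //= => Ra.
have [w wW] : exists w, w \in W by apply/set0Pn; rewrite -card_gt0 W1.
have L0 : (0 < #|lblock W|)%N by rewrite card_gt0; apply/set0Pn; exists w; rewrite inE wW.
have R0 : (0 < #|rblock W|)%N by rewrite card_gt0; apply/set0Pn; exists w; rewrite inE wW.
apply: sn; move: E; rewrite -(prednK L0) -(prednK R0) La Ra !addSn !addnS -pqn => -[].
by move=> /addIn.
Qed.

Lemma cup_i_small i p a b : homogeneous_cochain p a -> (p < i)%N -> cup_i i a b = 0.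
Proof.
move=> ha pi; apply/funext => s; rewrite /cup_i big1 // => W /eqP W1.
rewrite ha ?mul0r //= => Lp.
have : (#|W| <= #|lblock W|)%N.
  by apply: subset_leq_card; apply/subsetP => u uW; rewrite inE uW.
rewrite W1 => iL; have : (i <= p)%N by rewrite -Lp; case: #|_| iL.
by rewrite leqNgt pi.
Qed.

(* Both blocks are the whole simplex, and x ^ 2 = x in F_2: this is Sq^0 = id. *)
Lemma cup_i_top n a : homogeneous_cochain n a -> cup_i n a a = a.
Proof.
move=> ha; apply/funext => s; have [sn|sn] := eqVneq (sdim s) n; last first.
  rewrite (homogeneous_cup_i (n := n) ha ha) ?ha //; exact/eqP.
rewrite /cup_i (big_pred1 setT) => [|W]; last first.
  rewrite [RHS]eqEcard subsetT cardsT card_ord /= -sn eqn_leq.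
  by have := max_card W; rewrite card_ord => ->.
have -> : lblock (n := sdim s) setT = setT by apply/setP => u; rewrite !inE.
have -> : rblock (n := sdim s) setT = setT by apply/setP => u; rewrite !inE.
rewrite face_setT; case: (a s) => -[|[|//]] ?; exact: val_inj.
Qed.

Lemma cup_iDl i a b c : cup_i i (a + b) c = cup_i i a c + cup_i i b c.
Proof.
apply/funext => s; rewrite !fctE /cup_i -big_split; apply: eq_bigr => W _.
by rewrite ?fctE mulrDl.
Qed.

Lemma cup_iDr i a b c : cup_i i a (b + c) = cup_i i a b + cup_i i a c.
Proof.
apply/funext => s; rewrite !fctE /cup_i -big_split; apply: eq_bigr => W _.
by rewrite ?fctE mulrDr.
Qed.

Lemma cup_i0l i a : cup_i i 0 a = 0.
Proof. by apply/funext => s; rewrite /cup_i big1 // => W _; rewrite mul0r. Qed.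

Lemma cup_i0r i a : cup_i i a 0 = 0.
Proof. by apply/funext => s; rewrite /cup_i big1 // => W _; rewrite mulr0. Qed.

Lemma cocycle_cup a b : is_cocycle a -> is_cocycle b -> is_cocycle (cup a b).
Proof.
move=> /is_cocycleP[ba ca] /is_cocycleP[bb cb]; apply/is_cocycleP; split.
  exact: bounded_cup_i.
by rewrite coboundary_cup ca cb /cup cup_i0l cup_i0r addr0.
Qed.

Lemma cocycle_square i a : is_cocycle a -> is_cocycle (cup_i i a a).
Proof.
move=> /is_cocycleP[ba ca]; apply/is_cocycleP; split; first exact: bounded_cup_i.
case: i => [|i]; first by rewrite (coboundary_cup a a) ca /cup cup_i0l cup_i0r addr0.
by rewrite coboundary_cup_iS ca cup_i0l cup_i0r addr0 add0r cochain_addrr.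
Qed.

(** The cross terms a cup_i b + b cup_i a form the coboundary of a cup_(i+1) b. *)
Lemma coh_class_squareD i a b : is_cocycle a -> is_cocycle b ->
  coh_class (cup_i i (a + b) (a + b)) =
  coh_class (cup_i i a a) + coh_class (cup_i i b b).
Proof.
move=> ca cb; rewrite -coh_classD; try exact: cocycle_square.
apply: (coh_class_eq (c := cup_i i.+1 a b)).
- by apply: cocycle_square; exact: cocycleD.
- by apply: cocycleD; exact: cocycle_square.
rewrite coboundary_cup_iS !(coboundary_cocycle ca, coboundary_cocycle cb).
rewrite cup_i0l cup_i0r cup_iDl !cup_iDr !add0r.
by apply/funext => s; rewrite !fctE; ring: F2_two.
Qed.

(** For i = 0 the square is d(c cup dc). Otherwise d(c cup_i dc) has the extra terms c cup_(i-1) dc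
    + dc cup_(i-1) c, which are d(c cup_(i-1) c). *)
Lemma coh_class_square_coboundary i c :
  is_cocycle (coboundary c) ->
  coh_class (cup_i i (coboundary c) (coboundary c)) = 0.
Proof.
move=> cc; have cc0 := coboundary_cocycle cc.
case: i => [|i].
  apply: (coh_class_coboundary (c := cup c (coboundary c))); first exact: cocycle_square.
  by rewrite coboundary_cup cc0 /cup cup_i0r addr0.
apply: (coh_class_coboundary (c := cup_i i.+1 c (coboundary c) + cup_i i c c)).
  exact: cocycle_square.
rewrite coboundaryD coboundary_cup_iS cc0 cup_i0r addr0.
case: i => [|i]; last rewrite coboundary_cup_iS; last first.
  by apply/funext => s; rewrite !fctE; ring: F2_two.
rewrite (coboundary_cup c c).
by apply/funext => s; rewrite !fctE /cup; ring: F2_two.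
Qed.

End Cohomology.

Lemma sum_ord_trunc (V : zmodType) (F : nat -> V) (P : pred nat) N K : (N <= K)%N ->
  (forall n, (N <= n)%N -> P n -> F n = 0) ->
  \sum_(n < K | P n) F n = \sum_(n < N | P n) F n.
Proof.
move=> NK F0; rewrite [RHS](big_ord_widen_cond K P F) // [RHS]big_mkcondr /=.
by apply: eq_bigr => n Pn; case: ltnP => // Nn; exact: F0.
Qed.

(** * Squares on classes and products with a class of degree 2 *)

Section Squares.
Variables (R : realType) (X : topologicalType).
Implicit Types (s t : sing R X) (a b c : cochain R X).
Implicit Types (x y : cohomology R X).

Lemma hpartD n a b : hpart n (a + b) = hpart n a + hpart n b.
Proof. by apply/funext => s; rewrite !fctE /hpart; case: ifP; rewrite ?addr0. Qed.

Lemma homogeneous_hpart n a : homogeneous_cochain n (hpart n a).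
Proof. by move=> s /eqP sn; rewrite /hpart (negPf sn). Qed.

Lemma hpart_id n a : homogeneous_cochain n a -> hpart n a = a.
Proof.
by move=> ha; apply/funext => s; rewrite /hpart; case: eqP => // sn; rewrite ha.
Qed.

Lemma hpart_vanishes N n a : vanishes_above N a -> (N < n)%N -> hpart n a = 0.
Proof.
move=> va Nn; apply/funext => s; rewrite /hpart; case: eqP => // sn.
by rewrite va ?sn.
Qed.

Lemma hpart_neq n k a : homogeneous_cochain n a -> k != n -> hpart k a = 0.
Proof.
move=> ha kn; apply/funext => s; rewrite /hpart; case: eqP => // sk.
by rewrite ha // sk; exact/eqP.
Qed.

Lemma coboundary_hpart n a : coboundary (hpart n a) = hpart n.+1 (coboundary a).
Proof.
apply/funext => s; rewrite /hpart; case: eqP => sn.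
  by apply: coboundary_ext => t; rewrite sn => -[->]; rewrite eqxx.
rewrite (@coboundary_ext _ _ s _ 0) ?coboundary0 // => t ts.
by case: eqP => // tn; case: sn; rewrite -ts tn.
Qed.

Lemma hpart0_coboundary a : hpart 0 (coboundary a) = 0.
Proof. by apply/funext => s; rewrite /hpart /coboundary; case: eqP. Qed.

Lemma cocycle_hpart n a : is_cocycle a -> is_cocycle (hpart n a).
Proof.
move=> /is_cocycleP[_ ca]; apply/is_cocycleP; split.
  exists n => s sn; apply: homogeneous_hpart; apply/eqP.
  by rewrite gtn_eqF.
rewrite coboundary_hpart ca; apply/funext => s; rewrite /hpart.
by rewrite if_same.
Qed.

Lemma sq_cochainE M k a : vanishes_above M a -> sq_cochain k a =
  \sum_(n < M.+1 | (k <= n)%N) cup_i (n - k) (hpart n a) (hpart n a).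
Proof.
move=> va; apply/funext => s; rewrite fct_sumE /sq_cochain.
pose F n := cup_i (n - k) (hpart n a) (hpart n a) s.
rewrite -(@sum_ord_trunc _ F (leq k) _ (maxn (sdim s) M).+1); last 2 first.
- by rewrite ltnS leq_maxl.
(* The summand of index n has degree n + k, which exceeds the dimension of s. *)
- move=> n sn kn; apply: (@homogeneous_cup_i _ _ _ n n (n + k)).
  + exact: homogeneous_hpart.
  + exact: homogeneous_hpart.
  + by rewrite -addnA subnKC.
  by apply/eqP; rewrite ltn_eqF // (leq_trans sn) // leq_addr.
rewrite (@sum_ord_trunc _ F (leq k) M.+1) // => [|n Mn kn].
  by rewrite ltnS leq_maxr.
by rewrite /F (hpart_vanishes va Mn) cup_i0l.
Qed.

Definition coh_sq_part k n a := coh_class (cup_i (n - k) (hpart n a) (hpart n a)).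

Lemma coh_class_sq_cochain M k a : is_cocycle a -> vanishes_above M a ->
  coh_class (sq_cochain k a) = \sum_(n < M.+1 | (k <= n)%N) coh_sq_part k n a.
Proof.
move=> ca va; rewrite (sq_cochainE _ va) coh_class_sum // => n _.
by apply: cocycle_square; exact: cocycle_hpart.
Qed.

Lemma coh_sq_partD k n a b : is_cocycle a -> is_cocycle b ->
  coh_sq_part k n (a + b) = coh_sq_part k n a + coh_sq_part k n b.
Proof.
by move=> ca cb; rewrite /coh_sq_part hpartD coh_class_squareD //; exact: cocycle_hpart.
Qed.

Lemma coh_sq_part_coboundary k n c : is_cocycle (coboundary c) ->
  coh_sq_part k n (coboundary c) = 0.
Proof.
move=> cc; have := cocycle_hpart n cc; rewrite /coh_sq_part.
case: n => [|n]; first by rewrite hpart0_coboundary cup_i0l coh_class0.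
by rewrite -coboundary_hpart => ch; exact: coh_class_square_coboundary.
Qed.

Lemma coh_sq_part_vanishes M k n a : vanishes_above M a -> (M < n)%N ->
  coh_sq_part k n a = 0.
Proof.
by move=> va Mn; rewrite /coh_sq_part (hpart_vanishes va Mn) cup_i0l coh_class0.
Qed.

(** Independence of the representative: [coh_rep] differs from [a] by a coboundary, whose squares
    are zero in cohomology. *)
Lemma coh_sqE M k a : is_cocycle a -> vanishes_above M a ->
  coh_sq k (coh_class a) = \sum_(n < M.+1 | (k <= n)%N) coh_sq_part k n a.
Proof.
move=> ca va; have [c rE] := coh_rep_class ca; have cr := coh_rep_cocycle (coh_class a).
have [N vr] := bounded_cocycle cr.
have cc : is_cocycle (coboundary c).
  rewrite (_ : coboundary c = coh_rep (coh_class a) + a); first exact: cocycleD.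
  by rewrite rE addrAC cochain_addrr add0r.
rewrite /coh_sq (coh_class_sq_cochain k cr vr).
rewrite -(@sum_ord_trunc _ (fun n => coh_sq_part k n (coh_rep (coh_class a)))
  (leq k) _ (maxn M N).+1); last 2 first.
- by rewrite ltnS leq_maxr.
- by move=> n Nn _; exact: (coh_sq_part_vanishes _ vr).
rewrite -(@sum_ord_trunc _ (fun n => coh_sq_part k n a)
  (leq k) _ (maxn M N).+1); last 2 first.
- by rewrite ltnS leq_maxl.
- by move=> n Mn _; exact: (coh_sq_part_vanishes _ va).
apply: eq_bigr => n _.
by rewrite rE coh_sq_partD // coh_sq_part_coboundary // addr0.
Qed.

Lemma coh_sqD k x y : coh_sq k (x + y) = coh_sq k x + coh_sq k y.
Proof.
rewrite -(coh_repK x) -(coh_repK y).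
move: (coh_rep_cocycle x) (coh_rep_cocycle y).
move: (coh_rep x) (coh_rep y) => a b ca cb.
have [M va] := bounded_cocycle ca; have [N vb] := bounded_cocycle cb.
have va' : vanishes_above (maxn M N) a.
  by move=> s; rewrite gtn_max => /andP[/va].
have vb' : vanishes_above (maxn M N) b.
  by move=> s; rewrite gtn_max => /andP[_ /vb].
have vab : vanishes_above (maxn M N) (a + b).
  by move=> s sMN; rewrite fctE va' ?vb' ?addr0.
rewrite -coh_classD // (coh_sqE _ (cocycleD ca cb) vab) (coh_sqE _ ca va') (coh_sqE _ cb vb').
by rewrite -big_split; apply: eq_bigr => n _; exact: coh_sq_partD.
Qed.

Lemma coh_sq0 k : coh_sq k (0 : cohomology R X) = 0.
Proof. by apply: (addrI (coh_sq k 0)); rewrite -coh_sqD !addr0. Qed.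

Lemma coh_sq_homogeneous n k a : is_cocycle a -> homogeneous_cochain n a ->
  coh_sq k (coh_class a) = if (k <= n)%N then coh_class (cup_i (n - k) a a) else 0.
Proof.
move=> ca ha; rewrite (@coh_sqE n) //; last first.
  by move=> s sn; apply: ha; apply/eqP; rewrite gtn_eqF.
rewrite big_mkcond big_ord_recr /= big1 ?add0r => [|i _].
  by rewrite /coh_sq_part hpart_id.
by rewrite /coh_sq_part (hpart_neq ha) ?ltn_eqF // cup_i0l coh_class0 if_same.
Qed.

Lemma coh_mul_class a b : is_cocycle a -> is_cocycle b ->
  coh_mul (coh_class a) (coh_class b) = coh_class (cup a b).
Proof.
move=> ca cb; have [c rE] := coh_rep_class ca; have [d r'E] := coh_rep_class cb.
rewrite /coh_mul; apply: (coh_class_eq (c := cup a d + cup c (b + coboundary d))).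
- by apply: cocycle_cup; exact: coh_rep_cocycle.
- exact: cocycle_cup.
have cd : coboundary (coboundary d) = 0.
  rewrite (_ : coboundary d = coh_rep (coh_class b) + b).
    rewrite coboundaryD (coboundary_cocycle cb) addr0.
    exact: coboundary_cocycle (coh_rep_cocycle _).
  by rewrite r'E addrAC cochain_addrr add0r.
rewrite coboundaryD !coboundary_cup coboundaryD cd.
rewrite !(coboundary_cocycle cb, coboundary_cocycle ca).
rewrite rE r'E /cup !(cup_iDl, cup_iDr) !(cup_i0l, cup_i0r, add0r, addr0).
by apply/funext => s; rewrite !fctE; ring: F2_two.
Qed.

Lemma coh_mul0l y : coh_mul 0 y = 0.
Proof.
rewrite -(coh_repK y) -coh_class0 coh_mul_class ?coh_rep_cocycle ?cocycle0 //.
by rewrite /cup cup_i0l.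
Qed.

Lemma coh_mul0r y : coh_mul y 0 = 0.
Proof.
rewrite -(coh_repK y) -coh_class0 coh_mul_class ?coh_rep_cocycle ?cocycle0 //.
by rewrite /cup cup_i0r.
Qed.

(** The sum of [cartan_cochain] is reversed so that [q] belongs to b: for b of degree 2, only q = 0,
    1, 2 can contribute. *)
Lemma cartan_formula i a b : is_cocycle a -> is_cocycle b ->
  coh_class (cup_i i (cup a b) (cup a b)) =
  \sum_(q < i.+1) coh_mul (coh_class (cup_i (i - q) a a)) (coh_class (cup_i q b b)).
Proof.
move=> ca cb.
have cF (p : 'I_i.+1) : true -> is_cocycle (cup (cup_i p a a) (cup_i (i - p) b b)).
  by move=> _; apply: cocycle_cup; exact: cocycle_square.
have [c E] := cartan_cochain i (coboundary_cocycle ca) (coboundary_cocycle cb).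
rewrite (coh_class_eq _ _ E); last first.
- exact: cocycle_sum.
- by apply: cocycle_square; exact: cocycle_cup.
rewrite coh_class_sum // (reindex_inj rev_ord_inj) /=; apply: eq_bigr => q _.
rewrite coh_mul_class; try exact: cocycle_square.
by rewrite subSS subKn // -ltnS.
Qed.

(** b cup_q b is the square of b for q = 0, zero in cohomology for q = 1 by assumption, b itself for
    q = 2 and zero beyond. Here i = n + 2 - k, so the partners of q = 2 and q = 0 are Sq^k a and
    Sq^(k-2) a. *)
Lemma cartan_degree2 n k a b : is_cocycle a -> homogeneous_cochain n a ->
  is_cocycle b -> homogeneous_cochain 2 b -> coh_class (cup_i 1 b b) = 0 ->
  coh_sq k (coh_class (cup a b)) =
  coh_mul (coh_sq k (coh_class a)) (coh_class b) +
  (if (2 <= k)%N then coh_mul (coh_sq (k - 2) (coh_class a)) (coh_class (cup b b)) else 0).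
Proof.
move=> ca ha cb hb b1.
have hab : homogeneous_cochain (n + 2) (cup a b).
  by apply: (homogeneous_cup_i ha hb); rewrite addn0.
rewrite (coh_sq_homogeneous _ (cocycle_cup ca cb) hab) !(coh_sq_homogeneous _ ca ha).
rewrite leq_subLR [(2 + n)%N]addnC.
have [kn2|kn2] := leqP k (n + 2); last first.
  rewrite [(k <= n)%N]leqNgt (leq_trans _ kn2) ?leq_addr //= ?ltnS ?leq_addr //.
  by rewrite !coh_mul0l if_same addr0.
rewrite cartan_formula //; set i := (n + 2 - k)%N.
pose F q := coh_mul (coh_class (cup_i (i - q) a a)) (coh_class (cup_i q b b)).
have F1 : F 1%N = 0 by rewrite /F b1 coh_mul0r.
have F3 q : F q.+3 = 0 by rewrite /F (@cup_i_small _ _ _ 2 b b hb) // coh_class0 coh_mul0r.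
have -> : \sum_(q < i.+1) F q = F 0%N + (if (2 <= i)%N then F 2 else 0).
  case: (i) => [|[|j]]; rewrite ?big_ord_recl ?big_ord0 //= ?F1 ?addr0 //.
  by rewrite add0r big1 ?addr0.
rewrite addrC; congr (_ + _).
  rewrite (_ : (1 < i)%N = (k <= n)%N); last by rewrite /i ltn_subRL addn1 addn2 !ltnS.
  have [kn|kn] := leqP k n; last by rewrite coh_mul0l.
  rewrite /F (cup_i_top hb) (_ : i - 2 = n - k)%N //.
  by rewrite /i -addnBAC // addnK.
(* If k < 2 then i > n, and a cup_i a is zero. *)
have [k2|k2] := leqP 2 k; last first.
  have ni : (n < i)%N by rewrite /i ltn_subRL [(k + n)%N]addnC ltn_add2l.
  by rewrite /F subn0 (@cup_i_small _ _ _ n a a ha ni) coh_class0 coh_mul0l.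
by rewrite /F subn0 (_ : n - (k - 2) = i)%N // /i subnBA.
Qed.

End Squares.

(** * Naturality of the squares *)

Section Naturality.
Variables (R : realType) (X Y : topologicalType) (f : continuousType X Y).
Implicit Types (a b : cochain R Y).

Definition pullback a : cochain R X := fun s => a (push f s).

Lemma push_face (s : sing R X) V : push f (face s V) = face (push f s) V.
Proof. exact: eq_sing. Qed.

Lemma pullback_cup_i i a b : pullback (cup_i i a b) = cup_i i (pullback a) (pullback b).
Proof.
apply/funext => s; rewrite /pullback /cup_i; apply: eq_bigr => W _.
by rewrite !push_face.
Qed.

Lemma pullback_coboundary a : pullback (coboundary a) = coboundary (pullback a).
Proof.
apply/funext => s; rewrite /pullback /coboundary /=; case: ifP => // _.
by apply: eq_bigr => i _; rewrite push_face.
Qed.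

Lemma pullbackD a b : pullback (a + b) = pullback a + pullback b.
Proof. by []. Qed.

Lemma pullback_homogeneous n a :
  homogeneous_cochain n a -> homogeneous_cochain n (pullback a).
Proof. by move=> ha s sn; exact: ha. Qed.

Lemma pullback_cocycle a : is_cocycle a -> is_cocycle (pullback a).
Proof.
move=> /is_cocycleP[[N va] ca]; apply/is_cocycleP; split.
  by exists N => s sN; exact: va.
by rewrite -pullback_coboundary ca.
Qed.

Lemma coh_map_class a : is_cocycle a -> coh_map f (coh_class a) = coh_class (pullback a).
Proof.
move=> ca; have [c rE] := coh_rep_class ca.
rewrite /coh_map; apply: (coh_class_eq (c := pullback c)).
- exact: (pullback_cocycle (coh_rep_cocycle _)).
- exact: pullback_cocycle.
rewrite -pullback_coboundary -[X in X + _]/(pullback (coh_rep (coh_class a))) -pullbackD.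
by congr pullback; rewrite rE addrAC cochain_addrr add0r.
Qed.

Lemma pullback_sq_cochain k a : pullback (sq_cochain k a) = sq_cochain k (pullback a).
Proof.
apply/funext => s; rewrite /pullback /sq_cochain; apply: eq_bigr => n _.
rewrite -[LHS]/(pullback _ s) pullback_cup_i; congr (cup_i _ _ _ s).
Qed.

Lemma cocycle_sq_cochain k a : is_cocycle a -> is_cocycle (sq_cochain k a).
Proof.
move=> ca; have [M va] := bounded_cocycle ca; rewrite (sq_cochainE k va).
by apply: cocycle_sum => n _; apply: cocycle_square; exact: cocycle_hpart.
Qed.

Lemma coh_sq_class k a : is_cocycle a -> coh_sq k (coh_class a) = coh_class (sq_cochain k a).
Proof.
move=> ca; have [M va] := bounded_cocycle ca.
by rewrite (coh_sqE k ca va) (coh_class_sq_cochain k ca va).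
Qed.

End Naturality.

Lemma coh_map_sq (R : realType) (X Y : topologicalType) (f : continuousType X Y) k
    (y : cohomology R Y) : coh_map f (coh_sq k y) = coh_sq k (coh_map f y).
Proof.
rewrite -(coh_repK y); have cy := coh_rep_cocycle y.
rewrite coh_sq_class // !coh_map_class //; last exact: cocycle_sq_cochain.
by rewrite coh_sq_class ?pullback_sq_cochain //; exact: pullback_cocycle.
Qed.

(** * Polynomials *)

Section PolynomialSquares.
Variable m : nat.
Local Notation P := (mpoly m 'F_2).
Local Notation pi := (pihomog (@mon_deg m)).
Implicit Types (p q : P) (u v : multinom m).

Lemma mon_pihomogX d u :
  pi d (mpolyX 'F_2 u) = if mon_deg u == d then mpolyX 'F_2 u else 0.
Proof. exact: pihomogX. Qed.

Lemma mpoly_F2_ind (Q : P -> Prop) : Q 0 ->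
  (forall u p, Q p -> Q (mpolyX 'F_2 u + p)) -> forall p, Q p.
Proof.
move=> Q0 QD; apply: mpolyind => // c u p _ c0 Qp.
have -> : c = 1 by case: c c0 => -[|[|//]] ? // _; exact: val_inj.
by rewrite scale1r; exact: QD.
Qed.

Lemma poly_sq_widen M k p : (mmeasure (@mon_deg m) p <= M)%N ->
  poly_sq k p = \sum_(d < M) pi (d + k)%N (total_sq (pi d p)).
Proof.
move=> pM; rewrite /poly_sq.
rewrite -(@sum_ord_trunc _ (fun d => pi (d + k)%N (total_sq (pi d p))) predT _ M) //.
move=> d pd _; rewrite (_ : pi d p = 0) ?/total_sq ?comp_mpoly0 ?pihomog0 //.
rewrite pihomogE big_seq_cond big_pred0 // => u; apply/andP => -[up /eqP ud].
by have := mmeasure_mnm_lt (@mon_deg m) up; rewrite ud ltnNge pd.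
Qed.

Lemma total_sqD p q : total_sq (p + q) = total_sq p + total_sq q.
Proof. exact: comp_mpolyD. Qed.

Lemma total_sqM p q : total_sq (p * q) = total_sq p * total_sq q.
Proof. exact: rmorphM. Qed.

Lemma poly_sqD k p q : poly_sq k (p + q) = poly_sq k p + poly_sq k q.
Proof.
pose M := maxn (mmeasure (@mon_deg m) p) (mmeasure (@mon_deg m) q).
rewrite (@poly_sq_widen M) ?mmeasureD_le // (@poly_sq_widen M k p) ?leq_maxl //.
rewrite (@poly_sq_widen M k q) ?leq_maxr // -big_split.
by apply: eq_bigr => d _; rewrite pihomogD total_sqD pihomogD.
Qed.

Lemma poly_sq0 k : poly_sq k (0 : P) = 0.
Proof. by rewrite /poly_sq mmeasure0 big_ord0. Qed.

Lemma poly_sqX k u : poly_sq k (mpolyX 'F_2 u) =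
  pi (mon_deg u + k)%N (total_sq (mpolyX 'F_2 u)).
Proof.
rewrite /poly_sq mmeasureX big_ord_recr big1 /= => [|d _].
  by rewrite add0r mon_pihomogX eqxx.
by rewrite mon_pihomogX gtn_eqF // /total_sq comp_mpoly0 pihomog0.
Qed.

Lemma pihomog_mulX d p v : pi (d + mon_deg v)%N (p * mpolyX 'F_2 v) = pi d p * mpolyX 'F_2 v.
Proof.
elim/mpoly_F2_ind: p => [|u p IHp]; first by rewrite mul0r !pihomog0 mul0r.
rewrite mulrDl !pihomogD mulrDl IHp -mpolyXD !mon_pihomogX mon_degD eqn_add2r.
by case: ifP; rewrite ?mpolyXD ?mul0r.
Qed.

Lemma pihomog_mulX_small d p v : (d < mon_deg v)%N -> pi d (p * mpolyX 'F_2 v) = 0.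
Proof.
move=> dv; elim/mpoly_F2_ind: p => [|u p IHp]; first by rewrite mul0r pihomog0.
rewrite mulrDl pihomogD IHp addr0 -mpolyXD mon_pihomogX mon_degD gtn_eqF //.
exact: ltn_addl.
Qed.

Lemma total_sq_var (j : 'I_m) : total_sq (x_ j) =
  mpolyX 'F_2 (mnm1 j) + mpolyX 'F_2 (mnm_add (mnm1 j) (mnm1 j)).
Proof.
rewrite /total_sq /x_ comp_mpolyXU -tnth_nth tnth_mktuple mpolyXD.
by rewrite expr2.
Qed.

Lemma mon_deg_var (j : 'I_m) : mon_deg (mnm1 j) = 2%N.
Proof. by rewrite /mon_deg mdeg1. Qed.

Lemma mnm_ind (Q : multinom m -> Prop) : Q (@mnm0 m) ->
  (forall u j, Q u -> Q (mnm_add u (mnm1 j))) -> forall u, Q u.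
Proof.
move=> Q0 QD u; elim: {u}(mdeg u) {-2}u (erefl (mdeg u)) => [|n IHn] u du.
  by have /eqP -> : u == @mnm0 m by rewrite -mdeg_eq0 du.
have [j uj] : exists j, u j != 0%N.
  apply: contrapT => /forallNP H.
  have : mdeg u == 0%N.
    by rewrite mdegE; apply/eqP; apply: big1 => j _; apply/eqP/negPn/negP; exact: H.
  by rewrite du.
have uE : mnm_add (mnm_sub u (mnm1 j)) (mnm1 j) = u by apply: submK; rewrite lep1mP.
rewrite -uE; apply/QD/IHn; apply/eqP.
by rewrite -eqSS -du -[in X in _ == X]uE mdegD mdeg1 addn1.
Qed.

(** Every term of x_j + x_j^2 has at least the degree of x_j, so the total square lowers no
    degree. *)
Lemma total_sq_low u d : (d < mon_deg u)%N -> pi d (total_sq (mpolyX 'F_2 u)) = 0.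
Proof.
elim/mnm_ind: u d => [|u j IHu] d; first by rewrite mon_deg0.
rewrite mon_degD mon_deg_var mpolyXD total_sqM total_sq_var mulrDr pihomogD => du.
have low v : (2 <= mon_deg v)%N -> pi d (total_sq (mpolyX 'F_2 u) * mpolyX 'F_2 v) = 0.
  move=> v2; have [dv|dv] := ltnP d (mon_deg v); first exact: pihomog_mulX_small.
  rewrite -(subnK dv) pihomog_mulX IHu ?mul0r //.
  by rewrite ltn_subLR // (leq_trans du) // addnC leq_add2r.
by rewrite !low ?addr0 // ?mon_degD !mon_deg_var.
Qed.

(** The polynomial counterpart of [cartan_degree2]: multiplying by x_j raises the degree as
    expected, by x_j^2 by two more. *)
Lemma poly_sq_mulX k u j :
  poly_sq k (mpolyX 'F_2 (mnm_add u (mnm1 j))) =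
  poly_sq k (mpolyX 'F_2 u) * x_ j +
  (if (2 <= k)%N then poly_sq (k - 2) (mpolyX 'F_2 u) * (x_ j * x_ j) else 0).
Proof.
rewrite !poly_sqX mpolyXD total_sqM total_sq_var mulrDr pihomogD; congr (_ + _).
  by rewrite mon_degD addnAC pihomog_mulX.
have D4 : mon_deg (mnm_add (mnm1 j) (mnm1 j)) = 4%N by rewrite mon_degD mon_deg_var.
have mulX4 d p := pihomog_mulX d p (mnm_add (mnm1 j) (mnm1 j)).
rewrite D4 in mulX4; rewrite /x_ -mpolyXD mon_degD mon_deg_var.
have [k2|k2] := leqP 2 k.
  rewrite (_ : mon_deg u + 2 + k = mon_deg u + (k - 2) + 4)%N.
    by rewrite mulX4.
  by rewrite -!addnA; congr (_ + _)%N; rewrite -{1}(subnK k2) addnCA.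
(* For k < 2 the cofactor of x_j^2 would have degree below that of [u]. *)
have [l|l] := ltnP (mon_deg u + 2 + k) 4.
  by apply: pihomog_mulX_small; rewrite D4.
rewrite -(subnK l) mulX4 total_sq_low ?mul0r //.
rewrite ltn_subLR // [X in (_ < X)%N]addnC -addnA ltn_add2l.
by rewrite (@leq_ltn_trans (2 + 1)) // leq_add2l -ltnS.
Qed.

Lemma poly_deg_odd n p : odd n -> poly_deg n p -> p = 0.
Proof.
move=> on /pihomog_dE <-; rewrite pihomogE big_pred0 // => u.
by apply/negbTE; apply: contraL on => /eqP <-; rewrite /mon_deg odd_double.
Qed.

End PolynomialSquares.

Lemma cocycle_unit (R : realType) (X : topologicalType) : is_cocycle (@unit_cochain R X).
Proof.
apply/is_cocycleP; split; first by exists 0 => s; rewrite lt0n /unit_cochain => /negPf ->.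
apply/funext => s; rewrite /coboundary; case: eqP => // /eqP s0.
rewrite (eq_bigr (fun=> ((sdim s).-1 == 0%N)%:R)) => [|i _]; last first.
  by rewrite /unit_cochain /= cardsC1 card_ord.
rewrite sumr_const card_ord; case: (sdim s) s0 => [|[|n]] //= _.
  exact/val_inj.
by rewrite mul0rn.
Qed.

Lemma homogeneous_unit (R : realType) (X : topologicalType) :
  homogeneous_cochain 0 (@unit_cochain R X).
Proof. by move=> s /eqP s0; rewrite /unit_cochain (negPf s0). Qed.

Lemma algebra_iso0 (R : realType) (X : topologicalType) (A : comNzRingType)
    (A_deg : nat -> A -> Prop) (f : cohomology R X -> A) :
  algebra_iso A_deg f -> f 0 = 0.
Proof. by move=> /algebra_isoD fD; apply: (addrI (f 0)); rewrite -fD !addr0. Qed.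

(** * Squares on the product of projective spaces *)

Section CPPower.
Variables (R : realType) (m : nat).
Variables (g : cohomology R (CPoo R)) (Phi : cohomology R (CPoo_power R m) -> mpoly m 'F_2).
Hypothesis g_deg : coh_degree 2 g.
Hypothesis Phi_iso : algebra_iso (@poly_deg m) Phi.
Hypothesis Phi_coord : forall j : 'I_m, Phi (coh_map (cp_coord R j) g) = x_ j.

Let PhiD : {morph Phi : x y / x + y} := algebra_isoD Phi_iso.
Let PhiM := algebra_isoM Phi_iso.

Let Phi0 : Phi 0 = 0 := algebra_iso0 Phi_iso.

Lemma coord_cocycle j : exists b, [/\ is_cocycle b, homogeneous_cochain 2 b,
  Phi (coh_class b) = x_ j & coh_class (cup_i 1 b b) = 0].
Proof.
have [b [cb hb gE]] := g_deg.
exists (pullback (cp_coord R j) b); split.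
- exact: pullback_cocycle.
- exact: pullback_homogeneous.
- by rewrite -coh_map_class // -gE.
have cb' := pullback_cocycle (cp_coord R j) cb.
apply: (bij_inj (algebra_iso_bij Phi_iso)); rewrite Phi0.
(* b cup_1 b has degree 2 + 2 - 1 = 3. *)
apply: (@poly_deg_odd _ 3) => //; apply: (algebra_iso_deg Phi_iso).
exists (cup_i 1 (pullback (cp_coord R j) b) (pullback (cp_coord R j) b)); split=> //.
  exact: cocycle_square.
by apply: (@homogeneous_cup_i _ _ 1 2 2) => //; exact: pullback_homogeneous.
Qed.

(** The induction keeps a homogeneous cocycle, the form in which [cartan_degree2] accepts its first
    factor. *)
Lemma monomial_sq u : exists a, [/\ is_cocycle a, homogeneous_cochain (mon_deg u) a,
  Phi (coh_class a) = mpolyX 'F_2 u &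
  forall k, Phi (coh_sq k (coh_class a)) = poly_sq k (mpolyX 'F_2 u)].
Proof.
elim/mnm_ind: u => [|u j [a [ca ha aE aS]]].
  exists (@unit_cochain R (CPoo_power R m)).
  have E : Phi (coh_class (@unit_cochain R (CPoo_power R m))) = mpolyX 'F_2 (@mnm0 m).
    by rewrite mpolyX0 -(algebra_iso1 Phi_iso).
  have h0 : homogeneous_cochain 0 (@unit_cochain R (CPoo_power R m)).
    exact: homogeneous_unit.
  split=> [||//|k]; [exact: cocycle_unit|by rewrite mon_deg0|].
  rewrite (coh_sq_homogeneous _ (cocycle_unit _ _) h0) poly_sqX mon_deg0 add0n.
  rewrite mpolyX0 /total_sq comp_mpoly1 -mpolyX0 mon_pihomogX mon_deg0 leqn0 eq_sym.
  case: eqP => [<-|_]; last exact: Phi0.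
  by rewrite (cup_i_top h0) E.
have [b [cb hb bE b1]] := coord_cocycle j.
exists (cup a b); split.
- exact: cocycle_cup.
- by apply: (homogeneous_cup_i ha hb); rewrite addn0 mon_degD mon_deg_var.
- by rewrite -coh_mul_class // PhiM aE bE mpolyXD.
move=> k; rewrite (cartan_degree2 _ ca ha cb hb b1) PhiD PhiM bE aS poly_sq_mulX.
congr (_ + _); case: ifP => _; last exact: Phi0.
by rewrite PhiM aS -(coh_mul_class cb cb) PhiM bE.
Qed.

Lemma Phi_sq p : exists2 x, Phi x = p & forall k, Phi (coh_sq k x) = poly_sq k p.
Proof.
elim/mpoly_F2_ind: p => [|u p [y yE yS]].
  by exists 0 => [|k]; rewrite ?coh_sq0 Phi0 ?poly_sq0.
have [a [ca ha aE aS]] := monomial_sq u.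
exists (coh_class a + y) => [|k]; first by rewrite PhiD aE yE.
by rewrite coh_sqD PhiD aS yS poly_sqD.
Qed.

End CPPower.

Theorem lemma3p1p2 (R : realType) (m : nat) (K : simplicial_complex m)
    (g : cohomology R (CPoo R)) (g_gen : degree2_generator g)
    (Phi : cohomology R (CPoo_power R m) -> mpoly m 'F_2)
    (Phi_iso : algebra_iso (@poly_deg m) Phi)
    (Phi_coord : forall j : 'I_m, Phi (coh_map (cp_coord R j) g) = x_ j)
    (Psi : cohomology R (DJ R K) -> SR_algebra K)
    (Psi_iso : algebra_iso (@SR_deg m K) Psi)
    (Psi_incl : forall a : cohomology R (CPoo_power R m),
       Psi (coh_map (DJ_incl R K) a) = SR_class K (Phi a)) :
  steenrod_algebra_iso (@SR_deg m K) (@SR_sq m K) Psi.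

Proof.
split=> //; have PsiD := algebra_isoD Psi_iso.
have Psi0 := algebra_iso0 Psi_iso.
have Psi_sq k x : Psi (coh_sq k x) = SR_sq k (Psi x).
  have g_deg : coh_degree 2 g by case: g_gen.
  (* The polynomial lifted is the very representative of [Psi x] on which [SR_sq] computes. *)
  have [a aE aS] := Phi_sq g_deg Phi_iso Phi_coord
    (repr (Psi x : {ideal_quot SR_idealr K})).
  have xE : x = coh_map (DJ_incl R K) a.
    apply: (bij_inj (algebra_iso_bij Psi_iso)).
    by rewrite Psi_incl aE /SR_class reprK.
  by rewrite {1}xE -coh_map_sq Psi_incl aS.
move=> theta x; rewrite /steenrod_act (big_morph Psi PsiD Psi0).
by apply: eq_bigr => w _; elim: w => //= k w <-; exact: Psi_sq.
Qed.
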